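(* (1) If $A$ is a right distributive centrally essential finite ring, then $A=A_1\times\cdots\times A_n$, where each $A_i$ ($i=1,\ldots,n$) is a commutative uniserial finite ring. In particular, $A$ is a commutative distributive ring. Conversely, any direct product $A_1\times\cdots\times A_n$ of finitely many commutative uniserial finite rings is a commutative distributive finite ring. (2) If $A$ is a right distributive, right or left Noetherian, centrally essential ring, then $A=A_1\times\cdots\times A_n$, where each $A_i$ ($i=1,\ldots,n$) is either a (not necessarily commutative) uniserial Artinian ring or a commutative Dedekind domain. In particular, $A$ is a distributive Noetherian ring. Conversely, any direct product $A_1\times\cdots\times A_n$ of finitely many rings, each of which is either a (not necessarily commutative) uniserial Artinian ring or a commutative Dedekind domain, is a distributive Noetherian ring; it is not necessarily commutative, since there exist non-commutative uniserial Artinian centrally essential rings.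
   Context: All rings are associative with a non-zero identity element. A ring $A$ with center $C$ is centrally essential if for every non-zero $a\in A$ there are non-zero central elements $c,d\in C$ with $ac=d$ (equivalently, the module $A_C$ is an essential extension of $C_C$). A module is distributive if the lattice of its submodules is distributive; a module is uniserial if any two of its submodules are comparable with respect to inclusion. A ring $A$ is right (left) distributive, right (left) uniserial, right (left) Noetherian or right (left) Artinian if the module $A_A$ (respectively ${}_AA$) has the corresponding property. A ring is called distributive, uniserial, Noetherian or Artinian (without a side) if both modules $A_A$ and ${}_AA$ have the corresponding property. *)

(* Defs.v *)
From HB Require Import structures.
From mathcomp Require Import all_boot all_order all_algebra.
From mathcomp Require Import fraction ring_quotient.
From mathcomp Require Import all_classical.

Set Implicit Arguments.
Unset Strict Implicit.
Unset Printing Implicit Defensive.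

Import GRing.Theory.
Local Open Scope classical_set_scope.
Local Open Scope ring_scope.

Definition submodule (R : nzRingType) (M : lmodType R) (X : set M) : Prop :=
  submod_closed [in X].

Definition submod_sum (R : nzRingType) (M : lmodType R) (X Y : set M) : set M :=
  [set x + y | x in X & y in Y].

Definition distributive_module (R : nzRingType) (M : lmodType R) : Prop :=
  forall X Y Z : set M, submodule X -> submodule Y -> submodule Z ->
    X `&` submod_sum Y Z = submod_sum (X `&` Y) (X `&` Z).

Definition uniserial_module (R : nzRingType) (M : lmodType R) : Prop :=
  forall X Y : set M, submodule X -> submodule Y -> X `<=` Y \/ Y `<=` X.

Definition noetherian_module (R : nzRingType) (M : lmodType R) : Prop :=
  forall X : nat -> set M,
    (forall n, submodule (X n)) -> (forall n, X n `<=` X n.+1) ->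
    exists N, forall n, (N <= n)%N -> X n = X N.

Definition artinian_module (R : nzRingType) (M : lmodType R) : Prop :=
  forall X : nat -> set M,
    (forall n, submodule (X n)) -> (forall n, X n.+1 `<=` X n) ->
    exists N, forall n, (N <= n)%N -> X n = X N.

Definition left_regular (A : nzRingType) : lmodType A := A^o.

(* Right A-modules are left modules over the opposite ring A^c: for a : A and
   x : right_regular A, the scaling a *: x is the product x * a of A, so the
   submodules of right_regular A are the right ideals of A. *)
Definition right_regular (A : nzRingType) : lmodType A^c := (A^c)^o.

Definition right_distributive_ring (A : nzRingType) : Prop :=
  distributive_module (right_regular A).

Definition distributive_ring (A : nzRingType) : Prop :=
  distributive_module (right_regular A) /\ distributive_module (left_regular A).

Definition uniserial_ring (A : nzRingType) : Prop :=
  uniserial_module (right_regular A) /\ uniserial_module (left_regular A).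

Definition right_noetherian_ring (A : nzRingType) : Prop :=
  noetherian_module (right_regular A).

Definition left_noetherian_ring (A : nzRingType) : Prop :=
  noetherian_module (left_regular A).

Definition noetherian_ring (A : nzRingType) : Prop :=
  right_noetherian_ring A /\ left_noetherian_ring A.

Definition artinian_ring (A : nzRingType) : Prop :=
  artinian_module (right_regular A) /\ artinian_module (left_regular A).

Definition commutative_ring (A : nzRingType) : Prop :=
  commutative (@GRing.mul A).

Definition finite_ring (A : nzRingType) : Prop := finite_set [set: A].

Definition central (A : nzRingType) (c : A) : Prop :=
  forall x : A, GRing.comm c x.

Definition centrally_essential (A : nzRingType) : Prop :=
  forall a : A, a != 0 ->
    exists c d : A, [/\ central c, central d, c != 0, d != 0 & a * c = d].

Definition ring_isomorphic (A B : nzRingType) : Prop :=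
  exists f : {rmorphism A -> B}, bijective f.

(* Noetherian, integrally closed in its fraction field, and every nonzero prime
   ideal is maximal; fields are allowed.  In the library, [idealr_closed]
   already requires the ideal to be proper. *)
Definition dedekind_domain (D : idomainType) : Prop :=
  [/\ noetherian_ring D,
      forall z : {fraction D},
        integralOver (@tofrac D) z -> exists a : D, z = tofrac a
    & forall P : set D,
        idealr_closed [in P] -> prime_idealr_closed [in P] -> P <> [set 0] ->
        forall J : set D, idealr_closed [in J] -> P `<=` J -> J = P].

Definition is_dedekind_domain (A : nzRingType) : Prop :=
  exists D : idomainType, ring_isomorphic A D /\ dedekind_domain D.

(* The direct product B_0 x ... x B_n; there are n.+1 >= 1 factors because the
   empty product is the zero ring, which is excluded. *)
Definition ring_prod (n : nat) (B : 'I_n.+1 -> nzRingType) : Type :=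
  forall i, B i.

Section RingProd.
Variables (n : nat) (B : 'I_n.+1 -> nzRingType).
Local Notation P := (ring_prod B).
Implicit Types x y z : P.

HB.instance Definition _ := gen_eqMixin P.
HB.instance Definition _ := gen_choiceMixin P.

Definition prod_zero : P := fun=> 0.
Definition prod_one : P := fun=> 1.
Definition prod_opp x : P := fun i => - x i.
Definition prod_add x y : P := fun i => x i + y i.
Definition prod_mul x y : P := fun i => x i * y i.

Let prod_addA : associative prod_add.
Proof. by move=> x y z; apply: functional_extensionality_dep => i; exact: addrA. Qed.

Let prod_addC : commutative prod_add.
Proof. by move=> x y; apply: functional_extensionality_dep => i; exact: addrC. Qed.

Let prod_add0 : left_id prod_zero prod_add.
Proof. by move=> x; apply: functional_extensionality_dep => i; exact: add0r. Qed.

Let prod_addN : left_inverse prod_zero prod_opp prod_add.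
Proof. by move=> x; apply: functional_extensionality_dep => i; exact: addNr. Qed.

HB.instance Definition _ :=
  GRing.isZmodule.Build P prod_addA prod_addC prod_add0 prod_addN.

Let prod_mulA : associative prod_mul.
Proof. by move=> x y z; apply: functional_extensionality_dep => i; exact: mulrA. Qed.

Let prod_mul1l : left_id prod_one prod_mul.
Proof. by move=> x; apply: functional_extensionality_dep => i; exact: mul1r. Qed.

Let prod_mul1r : right_id prod_one prod_mul.
Proof. by move=> x; apply: functional_extensionality_dep => i; exact: mulr1. Qed.

Let prod_mulDl : left_distributive prod_mul prod_add.
Proof. by move=> x y z; apply: functional_extensionality_dep => i; exact: mulrDl. Qed.

Let prod_mulDr : right_distributive prod_mul prod_add.
Proof. by move=> x y z; apply: functional_extensionality_dep => i; exact: mulrDr. Qed.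

Let prod_one_neq0 : prod_one != 0.
Proof. by apply/eqP => /(congr1 (fun x : P => x ord0)) /eqP; rewrite oner_eq0. Qed.

HB.instance Definition _ :=
  GRing.Zmodule_isNzRing.Build P
    prod_mulA prod_mul1l prod_mul1r prod_mulDl prod_mulDr prod_one_neq0.

End RingProd.

(* Main.v *)
Require Import Defs.
From HB Require Import structures.
From mathcomp Require Import all_boot all_order all_algebra.
From mathcomp Require Import fraction ring_quotient mxpoly polyXY generic_quotient.
From mathcomp Require Import ring.
From mathcomp Require Import all_classical.

(** A right distributive ring is one in which, for all [a] and [b], there are
    [x + y = 1] with [a x] in [b A] and [b y] in [a A]; in this form the property
    passes to quotients and products.  Either Noetherian hypothesis enters
    through the ascending chain condition on two-sided ideals.

    In a centrally essential ring idempotents are central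
    ([idempotent_central]), so the chain condition splits [A] into finitely many
    rings without nontrivial idempotents ([primitive_decomposition],
    [corner_decomposition]).  For such a ring [A], a central element is nilpotent
    or regular ([central_nilpotent_or_regular]).  Let [S] be the annihilator of
    the central nilpotent elements inside the center.  It is an ideal of [A]
    meeting every nonzero right ideal, [A / N] is commutative for
    [N := {n | S n = 0}] because [s a b = b s a = s b a], and [N] is nil
    ([soc_mul], [soc_essential], [soc_ann_comm], [soc_ann_nil]).  Distributivity
    makes every element nilpotent or regular modulo [N], and then either [A] is a
    commutative domain or each of its elements is nilpotent or invertible
    ([indecomposable_dichotomy]).

    In the domain case the comaximality condition gives integral closedness and
    dimension one ([arithmetical_dedekind]).  In the local case any two right
    ideals are comparable, the maximal ideal is [m A] with [m] nilpotent, and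
    essentiality makes every commutator [a x - x a] a multiple [x r] with [r]
    nilpotent ([local_commutator]); hence [m A = A m], and the powers of [m]
    generate all one-sided ideals.  If [A] is moreover finite of residue
    characteristic [p], repeated [p]-th powers are central and represent every
    residue class, so [A] is generated by its center and [m], which makes it
    commutative ([finite_local_commutative]); and a finite domain is a field.

    Conversely, in a Dedekind domain any two elements are comparable for
    divisibility at each maximal ideal ([dedekind_arithmetical]), a uniserial
    ring that is Artinian on both sides is Noetherian
    ([chain_artinian_noetherian]), and both conditions are inherited by finite
    products.

    The non-commutative example extends [F := rat(X, Y)] by a square-zero ideal
    isomorphic to [F], with product
    [(a, a') (b, b') = (a b, a b' + a' b + D1 a * D2 b)] for the two partial
    derivatives [D1] and [D2]. *)

Set Implicit Arguments.
Unset Strict Implicit.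
Unset Printing Implicit Defensive.

Import GRing.Theory.
Local Open Scope classical_set_scope.
Local Open Scope ring_scope.

(** * One-sided ideals and elementwise forms of the module conditions *)

Section Elementwise.
Variable A : nzRingType.
Implicit Types (X Y Z : set A) (a b x y : A).

Definition right_ideal X : Prop :=
  [/\ X 0, forall x y, X x -> X y -> X (x + y) & forall x a, X x -> X (x * a)].

Definition divides_left a b : Prop := exists u, b = a * u.

(** The comaximality of the right ideals [{x | a x \in b A}] and
    [{y | b y \in a A}], for all [a] and [b]; over a commutative ring this is
    the condition defining arithmetical rings. *)
Definition arithmetical : Prop := forall a b, exists x y,
  [/\ x + y = 1, divides_left b (a * x) & divides_left a (b * y)].

Definition right_chain : Prop :=
  forall a b, divides_left a b \/ divides_left b a.

Lemma right_idealP X : submodule (X : set (right_regular A)) <-> right_ideal X.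
Proof.
split=> [[X0 Xlin]|[X0 XD XM]].
  have XD x y : X x -> X y -> X (x + y).
    move=> Xx Xy; have /set_mem := Xlin 1 _ _ (mem_set Xx) (mem_set Xy).
    by rewrite scale1r.
  split=> [|//|x a Xx]; first exact: set_mem X0.
  by have /set_mem := Xlin a _ _ (mem_set Xx) X0; rewrite addr0.
split=> [|a u v /set_mem Xu /set_mem Xv]; first exact: mem_set.
by apply: mem_set; apply: XD => //; exact: XM.
Qed.

Lemma principal_right_ideal a : right_ideal (divides_left a).
Proof.
split=> [|x y [u ->] [v ->]|x b [u ->]].
- by exists 0; rewrite mulr0.
- by exists (u + v); rewrite mulrDr.
- by exists (u * b); rewrite mulrA.
Qed.

(** Since [a = b + (a - b)], distributivity puts [a] in
    [aA `&` bA + aA `&` (a - b)A], whence the pair [(x, y)];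
    conversely such a pair splits any [x = y + z] along the sum of two
    submodules. *)
Lemma right_distributiveP : right_distributive_ring A <-> arithmetical.
Proof.
split=> [dist a b|arith X Y Z /right_idealP[X0 XD XM] /right_idealP[Y0 YD YM]
                     /right_idealP[Z0 ZD ZM]].
  have pr c := (right_idealP (divides_left c)).2 (principal_right_ideal c).
  have := dist _ _ _ (pr a) (pr b) (pr (a - b)).
  have aI : (divides_left a `&` @submod_sum _ (right_regular A)
              (divides_left b) (divides_left (a - b))) a.
    split; first by exists 1; rewrite mulr1.
    exists b; first by exists 1; rewrite mulr1.
    exists (a - b); first by exists 1; rewrite mulr1.
    by rewrite -[LHS]/(b + (a - b)) addrC subrK.
  move=> E; move: aI; rewrite E => -[u [[p up] [q uq]]].
  move=> [v [[r vr] [t vt]]] uv.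
  have Ea : a = u + v by [].
  exists (1 - t), t; split; first by rewrite subrK.
    exists (q - t); have at_v : a * t = v + b * t by rewrite vt mulrBl subrK.
    by rewrite !mulrBr mulr1 -uq at_v {1}Ea opprD addrA addrK.
  by exists (t - r); rewrite mulrBr -vr vt mulrBl opprB addrC subrK.
have split_sum (x y z : A) : X x -> Y y -> Z z -> x = y + z ->
    exists p q : A, [/\ p + q = x, X p, Y p, X q & Z q].
  move=> Xx Yy Zz xE; have [s [t [st [u Eu] [v Ev]]]] := arith y z.
  exists (x * t), (x * s); split; try exact: XM.
  - by rewrite -mulrDr addrC st mulr1.
  - by rewrite xE mulrDl Ev -mulrDr; exact: YM.
  - by rewrite xE mulrDl Eu -mulrDr; exact: ZM.
apply/seteqP; split=> [x|x].
  move=> [Xx [y Yy [z Zz xE]]].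
  have [p [q [pq Xp Yp Xq Zq]]] := split_sum x y z Xx Yy Zz (esym xE).
  by exists p => //; exists q.
move=> [y [Xy Yy] [z [Xz Zz] <-]]; split; first exact: XD.
by exists y => //; exists z.
Qed.

Lemma right_chain_arithmetical : right_chain -> arithmetical.
Proof.
move=> ch a b; have [ab|ba] := ch a b.
  exists 0, 1; rewrite add0r mulr0 mulr1; split=> //.
  by exists 0; rewrite mulr0.
exists 1, 0; rewrite addr0 mulr0 mulr1; split=> //.
by exists 0; rewrite mulr0.
Qed.

Lemma right_uniserialP : uniserial_module (right_regular A) <-> right_chain.
Proof.
split=> [uni a b|ch X Y /right_idealP[_ _ XM] /right_idealP[_ _ YM]].
  have pr c := (right_idealP (divides_left c)).2 (principal_right_ideal c).
  by case: (uni _ _ (pr a) (pr b)) => /= inc; [right|left]; apply: inc;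
    exists 1; rewrite mulr1.
have [XY|/existsNP[x /not_implyP[Xx nYx]]] := pselect (X `<=` Y); first by left.
right=> y Yy; have [[u ->]|[u xE]] := ch x y; first exact: XM.
by case: nYx; rewrite xE; apply: YM.
Qed.

End Elementwise.

(** The left-handed statements are the right-handed ones for the opposite ring:
    both sides unfold to the same conditions on subsets of the carrier. *)
Section Opposite.
Variable A : nzRingType.

Lemma left_distributiveP :
  distributive_module (left_regular A) <-> arithmetical A^c.
Proof. exact: (@right_distributiveP A^c). Qed.

Lemma left_uniserialP :
  uniserial_module (left_regular A) <-> right_chain A^c.
Proof. exact: (@right_uniserialP A^c). Qed.

End Opposite.

(** * The ascending chain condition on two-sided ideals *)

Lemma ascending_mono (T : Type) (X : nat -> set T) i j :
  (forall n, X n `<=` X n.+1) -> (i <= j)%N -> X i `<=` X j.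
Proof.
by move=> incr /subnK <-; elim: (j - i)%N => [//|k IH] x /IH/incr.
Qed.

Lemma unstable_chain_sequence (T : Type) (X : nat -> set T) :
  (forall n, X n `<=` X n.+1) ->
  ~ (exists N, forall n, (N <= n)%N -> X n = X N) ->
  exists (idx : nat -> nat) (y : nat -> T), [/\ forall k, (idx k <= idx k.+1)%N,
    forall k, X (idx k.+1) (y k) & forall k, ~ X (idx k) (y k)].
Proof.
move=> incr unstable.
have step n : exists Nx : nat * T, [/\ (n <= Nx.1)%N, X Nx.1 Nx.2 & ~ X n Nx.2].
  apply: contrapT => none; apply: unstable; exists n => N nN.
  apply/seteqP; split; last exact: ascending_mono.
  by move=> x XNx; apply: contrapT => nXx; apply: none; exists (N, x).
have [next nextP] := choice step.
exists (fun k => iter k (fun n => (next n).1) 0%N).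
exists (fun k => (next (iter k (fun n => (next n).1) 0%N)).2).
by split=> k /=; case: (nextP (iter k (fun n => (next n).1) 0%N)).
Qed.

Section Ideals.
Variable A : nzRingType.
Implicit Types (X Y : set A) (a b x y : A).

Definition ideal X : Prop :=
  [/\ X 0, forall x y, X x -> X y -> X (x + y), forall x a, X x -> X (x * a)
    & forall x a, X x -> X (a * x)].

Definition acc_ideals : Prop :=
  forall X : nat -> set A,
    (forall n, ideal (X n)) -> (forall n, X n `<=` X n.+1) ->
    exists N, forall n, (N <= n)%N -> X n = X N.

Lemma ideal_sub X x y : ideal X -> X x -> X y -> X (x - y).
Proof. by move=> [_ XD XM _] Xx Xy; rewrite -(mulrN1 y); apply/XD/XM. Qed.

Lemma ideal0 : ideal [set 0].
Proof. by split=> [|x y -> ->|x a ->|x a ->] //=; rewrite ?addr0 ?mul0r ?mulr0. Qed.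

Lemma noetherian_acc :
  right_noetherian_ring A \/ left_noetherian_ring A -> acc_ideals.
Proof.
by case=> noeth X Xid; apply: noeth => n; have [X0 XD XM MX] := Xid n;
  [apply/right_idealP | apply/(@right_idealP A^c)].
Qed.

Lemma acc_maximal (F : set (set A)) X0 : acc_ideals ->
  (forall X, F X -> ideal X) -> F X0 ->
  exists2 X, F X & forall Y, F Y -> X `<=` Y -> Y `<=` X.
Proof.
move=> acc Fid FX0; apply: contrapT => nomax.
have bigger (X : {X | F X}) : exists Y : {X | F X},
    sval X `<=` sval Y /\ ~ (sval Y `<=` sval X).
  case: X => X' FX; apply: contrapT => none; apply: nomax; exists X' => //.
  move=> Y FY XY; apply: contrapT => nYX; apply: none.
  by exists (exist _ Y FY); split.
have [next nextP] := choice bigger.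
pose Z n := iter n next (exist _ X0 FX0).
have [|n|N /(_ N.+1 (leqnSn N)) ZE] := acc (fun n => sval (Z n)).
- by move=> n; apply: Fid; exact: svalP (Z n).
- by have [] := nextP (Z n).
- by have [_] := nextP (Z N); rewrite -[next _]/(Z N.+1) ZE; apply.
Qed.

(** Stabilisation of annihilators: the elements [t] with [w k A t `<=` L] form a
    two-sided ideal, and these ideals ascend when each [w k.+1] is a left
    multiple of [w k]. *)
Lemma annihilators_stabilise (L : set A) (w : nat -> A) : acc_ideals ->
  ideal L -> (forall k, exists g, w k.+1 = g * w k) ->
  exists k, forall j t, (forall r, L (w (k + j)%N * r * t)) -> L (w k * t).
Proof.
move=> acc [L0 LD LM ML] wS.
pose T k := [set t | forall r, L (w k * r * t)].
have [k|k|N TN] := acc T.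
- split=> [r|x y Tx Ty r|x a Tx r|x a Tx r].
  + by rewrite mulr0.
  + by rewrite mulrDr; exact: LD.
  + by rewrite mulrA; exact: LM.
  + by rewrite mulrA -(mulrA (w k)); exact: Tx.
- move=> t Tt r; have [g ->] := wS k.
  by rewrite -!mulrA; apply: ML; rewrite mulrA.
- exists N => j t Tt; have : T N t by rewrite -(TN (N + j)%N (leq_addr _ _)).
  by move/(_ 1); rewrite mulr1.
Qed.

Lemma power_annihilators_stabilise (L : set A) a : acc_ideals -> ideal L ->
  exists k, forall j t, (forall r, L (a ^+ (k + j) * r * t)) -> L (a ^+ k * t).
Proof.
move=> acc idL; apply: (annihilators_stabilise acc idL) => k.
by exists a; rewrite exprS.
Qed.

(** A uniform choice: if each [d] in [D] can be sent into [N] by enlarging any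
    multiplier of [Z], then a single multiplier sends all of [D] into [N].  A
    multiplier [z] with [{t | t A z `<=` N}] maximal works; the commutation
    hypothesis says that this ideal meets [D] in [{d | d z \in N}]. *)
Lemma common_multiplier (N D Z : set A) z0 : acc_ideals -> ideal N ->
  (forall d r, D d -> N (d * r - r * d)) -> Z z0 ->
  (forall d z, D d -> Z z -> exists z', Z (z * z') /\ N (d * z * z')) ->
  exists2 z, Z z & forall d, D d -> N (d * z).
Proof.
move=> acc idN DC Zz0 step; have [N0 ND NM MN] := idN.
pose K z := [set t | forall r, N (t * r * z)].
have KE z d : D d -> N (d * z) -> K z d.
  move=> Dd dz r; rewrite -[d * r](subrK (r * d)) mulrDl; apply: ND.
    exact/NM/DC.
  by rewrite -mulrA; exact: MN.
have [X [z Zz <-] Kmax] : exists2 X, [set K z | z in Z] X &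
    forall Y, [set K z | z in Z] Y -> X `<=` Y -> Y `<=` X.
  apply: (@acc_maximal _ (K z0)) => // [_ [z _ <-]|]; last by exists z0.
  split=> [r|x y Kx Ky r|x a Kx r|x a Kx r].
  + by rewrite !mul0r.
  + by rewrite !mulrDl; exact: ND.
  + by rewrite -(mulrA x); exact: Kx.
  + by rewrite -(mulrA a) -(mulrA a); exact: MN.
exists z => // d Dd; have [z' [Zzz' dzz']] := step d z Dd Zz.
have /Kmax inc : [set K z | z in Z] (K (z * z')) by exists (z * z').
have /inc /(_ d) Kd : K z `<=` K (z * z').
  by move=> t Kt r; rewrite mulrA; exact: NM.
have /(_ 1) : K z d by apply: Kd; apply: KE => //; rewrite mulrA.
by rewrite mulr1.
Qed.

End Ideals.

(** * Centrally essential rings *)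

Section CentrallyEssential.
Variable A : nzRingType.
Implicit Types (a b c d e s t x y : A).

Definition nilpotent a : Prop := exists n, a ^+ n = 0.

Definition invertible a : Prop := exists b, a * b = 1 /\ b * a = 1.

Definition indecomposable : Prop := forall e, e * e = e -> e = 0 \/ e = 1.

Lemma invertible1B a : nilpotent a -> invertible (1 - a).
Proof.
move=> [n an]; exists (\sum_(i < n) a ^+ i).
have E : (1 - a) * (\sum_(i < n) a ^+ i) = 1.
  by apply: oppr_inj; rewrite -mulNr opprB -subrX1 an sub0r.
split=> //; rewrite -[RHS]E; apply: GRing.commr_sym.
apply: GRing.commr_sum => i _; apply: GRing.commrX.
by apply: GRing.commr_sym; apply: GRing.commrB; [exact: GRing.commr1|].
Qed.

Lemma right_invertible_nonnil a b : a * b = 1 -> ~ nilpotent a.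
Proof.
move=> ab [n]; elim: n => [|n IH]; first by move/eqP; rewrite expr0 oner_eq0.
by move=> an; apply: IH; rewrite -[_ ^+ n]mulr1 -ab mulrA -exprSr an mul0r.
Qed.

Lemma left_invertible_nonnil a b : b * a = 1 -> ~ nilpotent a.
Proof.
move=> ba [n]; elim: n => [|n IH]; first by move/eqP; rewrite expr0 oner_eq0.
by move=> an; apply: IH; rewrite -[_ ^+ n]mul1r -ba -mulrA -exprS an mulr0.
Qed.

Lemma invertible_nonnil a : invertible a -> ~ nilpotent a.
Proof. by move=> [b [ab _]]; exact: right_invertible_nonnil ab. Qed.

Lemma nilpotent_exp a n : nilpotent (a ^+ n) -> nilpotent a.
Proof. by move=> [k ak]; exists (n * k)%N; rewrite exprM. Qed.

Lemma centralX c n : central c -> central (c ^+ n).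
Proof. by move=> cc x; apply/GRing.commr_sym/GRing.commrX/GRing.commr_sym. Qed.

Lemma centralM c d : central c -> central d -> central (c * d).
Proof.
by move=> cc cd x; apply/GRing.commr_sym/GRing.commrM; apply/GRing.commr_sym.
Qed.

Lemma indecomposable_inverse a b : indecomposable -> a * b = 1 -> b * a = 1.
Proof.
move=> idem ab; have [||//] := idem (b * a).
- by rewrite mulrA -(mulrA b) ab mulr1.
- move=> ba0; have /eqP := oner_eq0 A; case.
  by rewrite -[LHS]mulr1 -ab mulrA -(mulrA a) ba0 mulr0 mul0r.
Qed.

Lemma indecomposable_invertible a b : indecomposable -> a * b = 1 -> invertible a.
Proof. by move=> idem ab; exists b; split=> //; exact: indecomposable_inverse. Qed.

(** Idempotents lift modulo a nil ideal: [e := 1 - (1 - y^k)^k] is a multiple of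
    [y^k] and [1 - e] is a multiple of [(1 - y)^k]. *)
Lemma indecomposable_lift y k : indecomposable ->
  (y * (1 - y)) ^+ k = 0 -> invertible y \/ invertible (1 - y).
Proof.
move=> idem yz0; set z := 1 - y in yz0 *.
have cyz : GRing.comm y z by apply: GRing.commrB; [exact: GRing.commr1|].
pose g := \sum_(i < k) y ^+ i; pose h := \sum_(i < k) (1 - y ^+ k) ^+ i.
have zg : z * g = 1 - y ^+ k.
  by apply: oppr_inj; rewrite -mulNr opprB opprB -subrX1.
have yh : y ^+ k * h = 1 - (1 - y ^+ k) ^+ k.
  apply: oppr_inj; rewrite -mulNr opprB [RHS]subrX1; congr (_ * _).
  by rewrite addrC addKr.
have cyg : GRing.comm y g.
  by apply: GRing.commr_sum => i _; exact: GRing.commrX.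
have cyk : GRing.comm y (1 - y ^+ k).
  by apply: GRing.commrB; [exact: GRing.commr1|exact: GRing.commrX].
have czg : GRing.comm z g.
  by apply/GRing.commr_sym/GRing.commrB; [exact: GRing.commr1|];
    apply: GRing.commr_sym.
have cyh : GRing.comm y h.
  by apply: GRing.commr_sum => i _; exact: GRing.commrX.
have czh : GRing.comm z h.
  by apply/GRing.commr_sym/GRing.commrB; [exact: GRing.commr1|];
    apply: GRing.commr_sym.
have E1 : 1 - y ^+ k * h = z ^+ k * g ^+ k.
  by rewrite yh opprB addrC subrK -zg exprMn_comm.
have e0 : y ^+ k * h * (1 - y ^+ k * h) = 0.
  have chz : GRing.comm h (z ^+ k) by apply/GRing.commrX/GRing.commr_sym.
  by rewrite E1 mulrA -(mulrA _ h) chz mulrA -exprMn_comm // yz0 !mul0r.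
have {}e0 : y ^+ k * h * (y ^+ k * h) = y ^+ k * h.
  by apply/esym/eqP; rewrite -subr_eq0 -{1}[_ * h]mulr1 -mulrBr e0.
case: k => [|k] in g h zg yh cyg cyk czg cyh czh E1 e0 yz0 *.
  by have /eqP := oner_eq0 A; case; rewrite -yz0 expr0.
have [E|E] := idem _ e0; [right|left].
  apply: (@indecomposable_invertible _ (z ^+ k * g ^+ k.+1)) => //.
  by rewrite mulrA -exprS -E1 E subr0.
apply: (@indecomposable_invertible _ (y ^+ k * h)) => //.
by rewrite mulrA -exprS.
Qed.

Section Idempotents.
Hypothesis ce : centrally_essential A.

(** If [d = e x (1 - e) c] with [c] and [d] central, then [d = e d = d e = 0]. *)
Lemma idempotent_central e : e * e = e -> central e.
Proof.
move=> ee.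
have ef x : e * x * (1 - e) = 0.
  apply/eqP/negP => /negP/ce[c [d [cc cd _ /eqP + dE]]]; apply.
  have -> : d = e * d by rewrite -dE !mulrA ee.
  rewrite -cd -dE -!mulrA cc !mulrA -(mulrA _ (1 - e)) mulrBl mul1r ee subrr.
  by rewrite mulr0 mul0r.
have fe x : (1 - e) * x * e = 0.
  apply/eqP/negP => /negP/ce[c [d [cc cd _ /eqP + dE]]]; apply.
  have -> : d = d * e by rewrite -dE -[RHS]mulrA cc !mulrA -(mulrA _ e e) ee.
  by rewrite cd -dE !mulrA mulrBr mulr1 ee subrr !mul0r.
move=> x; have := fe x; have := ef x.
rewrite mulrBr mulr1 !mulrBl mul1r => /subr0_eq exE /subr0_eq xeE.
by rewrite /GRing.comm exE.
Qed.
End Idempotents.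

End CentrallyEssential.

(** * Indecomposable right distributive centrally essential rings *)

Section Indecomposable.
Variable A : nzRingType.
Hypotheses (arith : arithmetical A) (ce : centrally_essential A).
Hypotheses (acc : acc_ideals A) (idem : indecomposable A).
Implicit Types (a b c d e f n p s t u v x y z : A).

(** If [K] is the stable annihilator of the powers of [c], distributivity gives
    for each [a] in [K] some [y] in [K] with [a = a y]; one [y] serves all
    central elements of [K].  By essentiality [y (1 - y) ^ j = 0] for some [j],
    and the idempotent [(1 - y) ^ j] is [0] or [1]. *)
Lemma central_nilpotent_or_regular c : central c ->
  nilpotent c \/ forall t, c * t = 0 -> t = 0.
Proof.
move=> cc.
have [k stab] := power_annihilators_stabilise c acc (ideal0 A).
have {}stab j t : c ^+ (k + j) * t = 0 -> c ^+ k * t = 0.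
  move=> ct; apply: (stab j) => r /=.
  by rewrite -mulrA (centralX _ cc) -mulrA -(centralX _ cc) ct mulr0.
set b := c ^+ k; have cb : central b := centralX k cc.
have stabb t : b * (b * t) = 0 -> b * t = 0.
  by rewrite mulrA -exprD; exact: stab.
pose K := [set t | b * t = 0].
have local a : K a -> exists2 y, K y & a * (1 - y) = 0.
  move=> Ka; have [x [y [xy [u au] [v bv]]]] := arith a b; exists y.
    by apply: stabb; rewrite bv mulrA Ka mul0r.
  rewrite -xy addrK au; apply: stabb.
  by rewrite -au mulrA Ka mul0r.
pose D := [set d | central d /\ K d].
have [z [y Ky zE] Dz] : exists2 z, [set 1 - y | y in K] z &
    forall d, D d -> d * z = 0.
  apply: (@common_multiplier _ [set 0] D [set 1 - y | y in K] 1) => //.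
  - exact: ideal0.
  - by move=> d r [cd _]; rewrite /= cd subrr.
  - by exists 0; rewrite ?subr0 //= /K /= mulr0.
  move=> d _ [cd Kd] [y Ky <-].
  have [|y' Ky' dy'] := local (d * (1 - y)); first by rewrite /K /= mulrA Kd mul0r.
  exists (1 - y'); split=> //=.
  exists (y + y' - y * y').
    by rewrite /K /= mulrBr mulrDr mulrA Ky Ky' mul0r addr0 subr0.
  by rewrite mulrBl mul1r mulrBr mulr1 [y + y']addrC -addrA opprD addrA.
have ze : y + z = 1 by rewrite -zE addrC subrK.
have czy : GRing.comm z y.
  by rewrite -zE; apply/GRing.commr_sym/GRing.commrB; [exact: GRing.commr1|].
have wS i : exists g, y * z ^+ i.+1 = g * (y * z ^+ i).
  by exists z; rewrite exprS !mulrA czy.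
have [j stabz] := annihilators_stabilise acc (ideal0 A) wS.
have yz0 : y * z ^+ j = 0.
  apply: contrapT => /eqP/ce[s [t [cs ct _ /eqP t0 tE]]]; apply: t0.
  have tz : t * z = 0.
    by apply: Dz; split=> //; rewrite /K /= -tE !mulrA Ky !mul0r.
  rewrite -tE; apply: (stabz 1%N) => r /=.
  rewrite -mulrA -(cs r) mulrA addn1 exprSr mulrA -(mulrA _ z) -(cs z) mulrA.
  by rewrite tE tz mul0r.
have zj i : z ^+ (j + i) = z ^+ j.
  elim: i => [|i IH]; first by rewrite addn0.
  by rewrite addnS exprS IH -[RHS]mul1r -ze mulrDl yz0 add0r.
have [zj0|zj1] := @idem (z ^+ j) (etrans (esym (exprD _ _ _)) (zj j)).
  left; apply: (nilpotent_exp (n := k)); exists 1%N; rewrite expr1 -/b.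
  have [w [yw _]] : invertible y.
    by rewrite -[y](addrK z) ze; apply: invertible1B; exists j.
  by rewrite -[b]mulr1 -yw mulrA Ky mul0r.
right=> t ct; have Kt : K t.
  by apply: (stab 1%N); rewrite addn1 exprSr -mulrA ct mulr0.
have z1 : z = 1 by rewrite -ze -[y]mulr1 -zj1 yz0 add0r.
apply: contrapT => /eqP/ce[s [d [cs cd _ /eqP d0 dE]]]; apply: d0.
rewrite -[d]mulr1 -z1; apply: Dz; split=> //.
by rewrite /K /= -dE mulrA Kt mul0r.
Qed.

(** This annihilator plays the role of a socle: it is closed under multiplication
    by [A] and meets every nonzero [a A]. *)
Definition soc s : Prop :=
  central s /\ forall p, central p -> nilpotent p -> s * p = 0.

Lemma soc_mul s a : soc s -> soc (s * a).
Proof.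
move=> [cs sP]; have killed p : central p -> nilpotent p -> s * a * p = 0.
  by move=> cp np; rewrite -mulrA -cp mulrA sP // mul0r.
split=> // x; have [-> |/eqP sa0] := pselect (s * a = 0).
  by rewrite /GRing.comm mul0r mulr0.
have [c [d [cc cd _ /eqP d0 dE]]] := ce sa0.
have [nc|reg] := central_nilpotent_or_regular cc.
  by case: d0; rewrite -dE killed.
apply/subr0_eq/reg; rewrite mulrBr cc [X in _ - X]cc -mulrA -(cc x) mulrA dE.
by rewrite -mulrA dE cd subrr.
Qed.

(** If [a c = d] is central, choose a central [p] with [d p <> 0] and the
    annihilator of [d p] maximal: no central nilpotent [q] can act on [d p]
    without killing it. *)
Lemma soc_essential a : a != 0 -> exists c, [/\ central c, soc (a * c) & a * c != 0].
Proof.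
move=> /ce[c [d [cc cd _ d0 dE]]].
pose Ann p := [set t | t * (d * p) = 0].
pose F := [set X | exists p, [/\ central p, d * p != 0 & X = Ann p]].
have [_ [p [cp dp0 ->]] pmax] : exists2 X, F X & forall Y, F Y -> X `<=` Y -> Y `<=` X.
  apply: (@acc_maximal _ _ (Ann 1)) => //.
    move=> _ [p [cp _ ->]]; have cdp := centralM cd cp.
    split=> [|x y Ax Ay|x r Ax|x r Ax]; rewrite /Ann /=.
    - by rewrite mul0r.
    - by rewrite mulrDl Ax Ay addr0.
    - by rewrite -mulrA -cdp mulrA Ax mul0r.
    - by rewrite -mulrA Ax mulr0.
  by exists 1; rewrite mulr1; split=> // x; exact/GRing.commr_sym/GRing.commr1.
exists (c * p); rewrite mulrA dE; split=> //; first exact: centralM.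
split; first exact: centralM.
move=> q cq [n qn]; have {qn} : d * (p * q ^+ n) = 0 by rewrite qn !mulr0.
elim: n => [|n IH qn]; first by rewrite expr0 mulr1 => E; rewrite E eqxx in dp0.
have [|/eqP dpqn] := pselect (d * (p * q ^+ n) = 0); first exact: IH.
have inc : Ann p `<=` Ann (p * q ^+ n).
  by move=> t tp; rewrite /Ann /= 2!mulrA -(mulrA t) tp mul0r.
have /pmax/(_ inc q) : F (Ann (p * q ^+ n)).
  by exists (p * q ^+ n); split=> //; apply: centralM => //; exact: centralX.
rewrite /Ann /= => qAnn; rewrite -cq; apply: qAnn.
by rewrite cq -!mulrA -exprSr.
Qed.

Definition soc_ann n : Prop := forall s, soc s -> s * n = 0.

Lemma ideal_soc_ann : ideal soc_ann.
Proof.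
split=> [s _|x y Nx Ny s Ss|x a Nx s Ss|x a Nx s Ss].
- by rewrite mulr0.
- by rewrite mulrDr Nx // Ny // addr0.
- by rewrite mulrA Nx // mul0r.
- by rewrite mulrA; apply/Nx/soc_mul.
Qed.

(** Since [s a] is central, [s a b = b s a = s b a]. *)
Lemma soc_ann_comm a b : soc_ann (a * b - b * a).
Proof.
move=> s Ss; have [csa _] := soc_mul a Ss; have [cs _] := Ss.
by rewrite mulrBr !mulrA csa mulrA -cs subrr.
Qed.

Lemma soc_ann_exp a b k : soc_ann ((a * b) ^+ k - a ^+ k * b ^+ k).
Proof.
have [N0 ND NM MN] := ideal_soc_ann.
elim: k => [|k IH]; first by rewrite !expr0 mulr1 subrr.
have -> : (a * b) ^+ k.+1 - a ^+ k.+1 * b ^+ k.+1 =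
    a * b * ((a * b) ^+ k - a ^+ k * b ^+ k) + a * (b * a ^+ k - a ^+ k * b) * b ^+ k.
  rewrite !exprS !mulrBr !mulrBl !mulrA addrA subrK.
  by [].
by apply: ND; [exact: MN|apply/NM/MN/soc_ann_comm].
Qed.

(** If [n ^ k <> 0] then some [n ^ k c], [c] central, is a nonzero element of the
    socle, and [n] kills it; this is impossible once the annihilators of the powers are stable. *)
Lemma soc_ann_nil n : soc_ann n -> nilpotent n.
Proof.
move=> Nn; have [k stab] := power_annihilators_stabilise n acc (ideal0 A).
exists k; apply: contrapT => /eqP/soc_essential[c [cc Sc /eqP c0]]; apply: c0.
apply: (stab 1%N) => r /=.
by rewrite -mulrA -(cc r) mulrA addn1 exprS -(mulrA n) -Sc.1 Nn // mul0r.
Qed.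

Lemma soc_ann_nilX x k : soc_ann (x ^+ k) -> nilpotent x.
Proof. by move/soc_ann_nil/nilpotent_exp. Qed.

(** For the stable [K' = {f | b f \in N}], [b] a power of [a], each [f] in [K']
    satisfies [f (1 - y) \in N] with [y] in [K']; a common [y] is idempotent
    modulo the nil ideal [N], so [y] or [1 - y] is invertible. *)
Lemma nilpotent_or_regular a :
  nilpotent a \/ forall f, soc_ann (a * f) -> soc_ann f.
Proof.
have [N0 ND NM MN] := ideal_soc_ann.
have comN x y : soc_ann (x * y) -> soc_ann (y * x).
  by move=> /ND/(_ (soc_ann_comm y x)); rewrite addrC subrK.
have [k stab] := power_annihilators_stabilise a acc ideal_soc_ann.
have {}stab j t : soc_ann (a ^+ (k + j) * t) -> soc_ann (a ^+ k * t).
  move=> at0; apply: (stab j) => r.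
  rewrite -[_ * r](subrK (r * a ^+ (k + j))) mulrDl; apply: ND.
    exact/NM/soc_ann_comm.
  by rewrite -mulrA; exact: MN.
set b := a ^+ k in stab.
have stabb t : soc_ann (b * (b * t)) -> soc_ann (b * t).
  by rewrite mulrA -exprD; exact: stab.
pose K := [set f | soc_ann (b * f)].
have local f : K f -> exists2 y, K y & soc_ann (f * (1 - y)).
  move=> Kf; have [x [y [xy [u fu] [v bv]]]] := arith f b; exists y.
    by apply: stabb; rewrite bv mulrA; exact: NM.
  by rewrite -xy addrK fu; apply: stabb; rewrite -fu mulrA; exact: NM.
have [z [y Ky zE] Kz] : exists2 z, [set 1 - y | y in K] z &
    forall d, K d -> soc_ann (d * z).
  apply: (@common_multiplier _ soc_ann K [set 1 - y | y in K] 1) => //.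
  - by move=> d r _; exact: soc_ann_comm.
  - by exists 0; rewrite ?subr0 //= /K /= mulr0.
  move=> d _ Kd [y Ky <-].
  have [|y' Ky' dy'] := local (d * (1 - y)); first by rewrite /K /= mulrA; exact: NM.
  exists (1 - y'); split=> //=.
  exists (y + y' - y * y').
    rewrite /K /= mulrBr mulrDr mulrA; apply: (ideal_sub ideal_soc_ann).
      exact: ND.
    exact: NM.
  by rewrite mulrBl mul1r mulrBr mulr1 [y + y']addrC -addrA opprD addrA.
have [j yj] : nilpotent (y * (1 - y)) by apply: soc_ann_nil; rewrite zE; exact: Kz.
have [[w [yw _]]|[w [zw _]]] := indecomposable_lift idem yj.
  left; apply: (@soc_ann_nilX _ k); rewrite -/b -[b]mulr1 -yw mulrA.
  exact: NM.
right=> f af; have Kf : K f.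
  apply: (stab 1%N); rewrite addn1 exprSr -mulrA; exact: MN.
by rewrite -[f]mulr1 -zw mulrA zE; apply/NM/Kz.
Qed.

Lemma regularX a k : ~ nilpotent a -> forall f, soc_ann (a ^+ k * f) -> soc_ann f.
Proof.
move=> na; have [//|reg] := nilpotent_or_regular a.
elim: k => [f|k IH f]; first by rewrite expr0 mul1r.
by rewrite exprS -mulrA => /reg/IH.
Qed.

(** Each nilpotent [d] is divisible by all powers of [a], so the chain condition
    yields [d (1 - a r)] in [N]; one [r] serves all nilpotent [d].
    As [a] is not invertible, [1 - a r] is not nilpotent, hence regular modulo
    [N]. *)
Lemma not_invertible_nil_soc a d : ~ nilpotent a -> ~ invertible a ->
  nilpotent d -> soc_ann d.
Proof.
have [N0 ND NM MN] := ideal_soc_ann.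
move=> na ua nd.
have expN x y k : soc_ann ((x * y) ^+ k) -> soc_ann (x ^+ k * y ^+ k).
  by move=> /(ideal_sub ideal_soc_ann)/(_ (soc_ann_exp x y k)); rewrite opprB addrC subrK.
(* A nilpotent [d'] is divisible by [a] because its comparison with [a] has a
   nilpotent first multiplier. *)
have divis d' : nilpotent d' -> exists2 v, nilpotent v & d' = a * v.
  move=> [m d'm]; have [x [y [xy [u au] [v dv]]]] := arith a d'.
  have /invertible1B : nilpotent x.
    apply: (@soc_ann_nilX _ m); apply: (@regularX a m na); apply: expN.
    rewrite au -[_ ^+ m]subr0 -(mul0r (u ^+ m)) -d'm; exact: soc_ann_exp.
  have -> : 1 - x = y by rewrite -xy addrAC subrr add0r.
  move=> [w [yw _]]; exists (v * w); last by rewrite mulrA -dv -mulrA yw mulr1.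
  apply: (@soc_ann_nilX _ m); apply: (@regularX a m na); apply: expN.
  by rewrite mulrA -dv -mulrA yw mulr1 d'm.
have chain d' : nilpotent d' -> exists r, soc_ann (d' * (1 - a * r)).
  move=> nd'; have pow k : exists2 v, nilpotent v & d' = a ^+ k * v.
    elim: k => [|k [v /divis[v' nv' ->] ->]]; first by exists d'; rewrite ?mul1r.
    by exists v'; rewrite // exprSr mulrA.
  pose L := [set t | exists r, soc_ann (t - d' * r)].
  have idL : ideal L.
    split=> [|x y [r xr] [r' yr']|x b [r xr]|x b [r xr]].
    - by exists 0; rewrite mulr0 subrr.
    - exists (r + r'); rewrite mulrDr opprD addrACA; exact: ND.
    - by exists (r * b); rewrite mulrA -mulrBl; exact: NM.
    exists (b * r); rewrite mulrA -[b * x](subrK (b * d' * r)) -addrA -mulrBl.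
    by apply: ND; [rewrite -mulrA -mulrBr; exact: MN|apply/NM/soc_ann_comm].
  have [k stab] := power_annihilators_stabilise a acc idL.
  have [v _ dv] := pow (k + 1)%N.
  have [r avr] : L (a ^+ k * v).
    apply: (stab 1%N) => r; exists r.
    rewrite -[X in X - _](subrK (r * a ^+ (k + 1) * v)) -addrA -mulrBl.
    by rewrite -(mulrA r) -dv; apply: ND; [apply/NM|]; exact: soc_ann_comm.
  exists r; have -> : d' * (1 - a * r) =
      a * (a ^+ k * v - d' * r) + (a * d' - d' * a) * r.
    by rewrite mulrBr mulr1 mulrBr mulrBl !mulrA addrA subrK -exprS -addn1 -dv.
  by apply: ND; [exact: MN|apply/NM/soc_ann_comm].
have [_ [r _ <-] nilz] : exists2 z, [set 1 - a * r | r in setT] z &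
    forall d, nilpotent d -> soc_ann (d * z).
  apply: (@common_multiplier A soc_ann (@nilpotent A) [set 1 - a * r | r in setT] 1) => //.
  - by move=> x r _; exact: soc_ann_comm.
  - by exists 0; rewrite ?mulr0 ?subr0.
  move=> x _ [m xm] [r _ <-].
  have [|r' xr'] := chain (x * (1 - a * r)).
    apply: (@soc_ann_nilX _ m).
    rewrite -[X in soc_ann X]subr0 -(mul0r ((1 - a * r) ^+ m)) -xm.
    exact: soc_ann_exp.
  exists (1 - a * r'); split=> //=; exists (r + r' - r * a * r') => //.
  rewrite [RHS]mulrBl mul1r [X in _ = _ - X]mulrBr mulr1 mulrBr mulrDr !mulrA.
  by rewrite [a * r + _]addrC -addrA opprD addrA.
have [nz|reg] := nilpotent_or_regular (1 - a * r).
  case: ua; have [w [arw _]] := invertible1B nz.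
  apply: (indecomposable_invertible (b := r * w) idem).
  by rewrite mulrA -[RHS]arw opprB addrC subrK.
apply: reg; rewrite -[X in soc_ann X](subrK (d * (1 - a * r))).
by apply: ND; [exact: soc_ann_comm|exact: nilz].
Qed.

(** Suppose [a] is neither nilpotent nor invertible.  Then [N := soc_ann] is
    completely prime.  If [1] is in the socle, then [N = 0] and [A] is a
    commutative domain.  Otherwise the socle squares to zero and is torsion-free
    over [A / N]; a faithful [s] in it is divisible by all [a^k], with quotients
    [v] that commute with [a^k], and the chain condition makes [a]
    invertible. *)
Theorem indecomposable_dichotomy :
  (commutative_ring A /\ forall x y, x * y = 0 -> x = 0 \/ y = 0) \/
  forall a, invertible a \/ nilpotent a.
Proof.
have [[a [na ua]]|none] := pselect (exists a, ~ nilpotent a /\ ~ invertible a);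
  last first.
  right=> a; have [|na] := pselect (nilpotent a); first by right.
  by left; apply: contrapT => ua; apply: none; exists a.
left; have [N0 ND NM MN] := ideal_soc_ann.
have nilN d : nilpotent d -> soc_ann d by exact: not_invertible_nil_soc na ua.
have prime x y : soc_ann (x * y) -> soc_ann x \/ soc_ann y.
  move=> xy; have [/nilN|reg] := nilpotent_or_regular x; first by left.
  by right; exact: reg.
have [S1|nS1] := pselect (soc 1).
  have N_eq0 n : soc_ann n -> n = 0 by move/(_ 1 S1); rewrite mul1r.
  split=> [x y|x y xy0]; first exact/subr0_eq/N_eq0/soc_ann_comm.
  by have [|/N_eq0|/N_eq0] := prime x y; [rewrite xy0|left|right].
have soc_nil s : soc s -> nilpotent s.
  move=> [cs sP]; have [//|reg] := central_nilpotent_or_regular cs.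
  case: nS1; split=> [x|p cp np]; first exact/GRing.commr_sym/GRing.commr1.
  by rewrite mul1r; apply/reg/sP.
have soc_sq s t : soc s -> soc t -> s * t = 0.
  by move=> Ss St; apply: Ss.2; [exact: St.1|exact: soc_nil].
have [s Ss sfaith] : exists2 s, soc s & forall f, s * f = 0 -> soc_ann f.
  apply: contrapT => nofaith.
  have killed s : soc s -> exists2 f, ~ soc_ann f & s * f = 0.
    move=> Ss; apply: contrapT => reg; apply: nofaith; exists s => // f sf0.
    by apply: contrapT => nf; apply: reg; exists f.
  have [z nz Dz] : exists2 z, [set z | ~ soc_ann z] z &
      forall d, soc d -> d * z = 0.
    apply: (@common_multiplier A [set 0] soc [set z | ~ soc_ann z] 1) => //.
    - exact: ideal0.
    - by move=> d r [cd _]; rewrite /= cd subrr.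
    - by move=> /soc_ann_nil; apply: invertible_nonnil; exists 1; rewrite mulr1.
    move=> d z Sd nz; have [f nf df] := killed _ (soc_mul z Sd).
    by exists f; split=> // /prime[].
  by apply: nz => d; exact: Dz.
have unit_pair x y : x + y = 1 -> soc_ann x -> invertible y.
  move=> xy /soc_ann_nil/invertible1B.
  by have -> : 1 - x = y by rewrite -xy addrAC subrr add0r.
(* Comparing [t] with the faithful [s]: the multiplier [x] of [s] is killed
   modulo [N] by [b], so [t] is a multiple of [s]. *)
have torsion_free t b : ~ soc_ann b -> soc t -> t * b = 0 -> t = 0.
  move=> nb St tb; have [x [y [xy [u su] [v tv]]]] := arith s t.
  have /(unit_pair _ _ xy)[w [yw _]] : soc_ann x.
    have : soc_ann (x * b).
      apply: sfaith; rewrite mulrA su -mulrA -[u * b](subrK (b * u)) mulrDr.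
      by rewrite (soc_ann_comm _ _ St) add0r mulrA tb mul0r.
    by case/prime.
  have tE : t = s * (v * w) by rewrite mulrA -tv -mulrA yw mulr1.
  have : soc_ann (v * w * b) by apply: sfaith; rewrite mulrA -tE.
  by case/prime=> // /(_ s Ss); rewrite -tE.
have left_torsion w b : ~ soc_ann b -> b * w = 0 -> w = 0.
  move=> nb bw; apply: contrapT => /eqP/soc_essential[c [cc Sc /eqP]]; apply.
  by apply: (torsion_free _ b) => //; rewrite Sc.1 mulrA bw mul0r.
have right_torsion w b : ~ soc_ann b -> w * b = 0 -> w = 0.
  move=> nb wb; apply: contrapT => /eqP/soc_essential[c [cc Sc /eqP]]; apply.
  by apply: (torsion_free _ b) => //; rewrite -mulrA cc mulrA wb mul0r.
have powN k : ~ soc_ann (a ^+ k) by move/soc_ann_nilX.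
(* [v] commutes with [a ^ k] because [a ^ k (v a ^ k - a ^ k v) = 0]; then
   [n v a ^ k = n s = 0] for [n] in [N]. *)
have quotient k : exists2 v, s = a ^+ k * v & forall n, soc_ann n -> n * v = 0.
  set b := a ^+ k; have [x [y [xy [u bu] [v sv]]]] := arith b s.
  have /(unit_pair _ _ xy)[w [yw _]] : soc_ann x.
    have : soc_ann (b * x).
      by apply: sfaith; rewrite bu mulrA (soc_sq _ _ Ss Ss) mul0r.
    by case/prime=> // /powN.
  have sE : s = b * (v * w) by rewrite mulrA -sv -mulrA yw mulr1.
  exists (v * w) => // n Nn; move: (v * w) sE => v' sE.
  have vbE : v' * b = b * v'.
    apply: subr0_eq; apply: (left_torsion _ b (powN k)).
    by rewrite mulrBr !mulrA -sE -mulrA -sE Ss.1 subrr.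
  apply: (right_torsion _ b (powN k)).
  by rewrite -mulrA vbE -sE -Ss.1 Nn.
have idL : ideal (divides_left s).
  have [L0 LD LM] := principal_right_ideal s; split=> // x c [u ->].
  by exists (c * u); rewrite mulrA -Ss.1 mulrA.
have [k stab] := power_annihilators_stabilise a acc idL.
have [v sv Nv] := quotient (k + 1)%N.
have [r avr] : divides_left s (a ^+ k * v).
  apply: (stab 1%N) => r; exists r; rewrite Ss.1 sv mulrA; apply: subr0_eq.
  by rewrite -mulrBl; apply/Nv/soc_ann_comm.
have /sfaith/soc_ann_nil/invertible1B[w [arw _]] : s * (1 - a * r) = 0.
  by rewrite mulrBr mulr1 mulrA Ss.1 -mulrA -avr mulrA -exprS -addn1 -sv subrr.
case: ua; apply: (indecomposable_invertible (b := r * w) idem).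
by rewrite mulrA -[RHS]arw opprB addrC subrK.
Qed.

End Indecomposable.

(** * Local rings whose one-sided ideals are the powers of one element *)

Lemma bounded_stable (f : nat -> nat) B :
  (forall n, f n <= f n.+1)%N -> (forall n, f n <= B)%N ->
  exists N, forall n, (N <= n)%N -> f n = f N.
Proof.
move=> fS fB; have homo : {homo f : m n / (m <= n)%N} := homo_leq leqnn leq_trans fS.
have exP : exists i, `[< exists n, f n = i >] by exists (f 0); apply/asboolP; exists 0.
have ubP i : `[< exists n, f n = i >] -> (i <= B)%N by move/asboolP => [n <-].
case: (ex_maxnP exP ubP) => _ /asboolP[N <-] maxN.
exists N => n Nn; apply/eqP; rewrite eqn_leq (homo _ _ Nn) andbT.
by apply: maxN; apply/asboolP; exists n.
Qed.

(** Every principal right ideal is a power [m^k A] of one nilpotent [m].  Mutual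
    divisibility states this without mentioning units, in a form that can be
    read in the opposite ring. *)
Definition nilpotently_generated (A : nzRingType) : Prop :=
  exists (m : A) (n : nat), m ^+ n = 0 /\
    forall x, exists k, divides_left (m ^+ k) x /\ divides_left x (m ^+ k).

Section PowerChain.
Variable A : nzRingType.
Hypothesis gen : nilpotently_generated A.

Lemma nilpotently_generated_chain : right_chain A.
Proof.
have [m [_ [_ mP]]] := gen => a b.
have [i [[u aE] [u' aE']]] := mP a; have [j [[v bE] [v' bE']]] := mP b.
have [ij|/ltnW ji] := leqP i j; [left|right].
  by exists (u' * m ^+ (j - i) * v); rewrite !mulrA -aE' -exprD subnKC.
by exists (v' * m ^+ (i - j) * u); rewrite !mulrA -bE' -exprD subnKC.
Qed.

(** A right ideal is determined by the least power of [m] that it contains. *)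
Lemma nilpotently_generated_artinian : artinian_module (right_regular A).
Proof.
have [m [n0 [mn mP]]] := gen => X /(_ _)/right_idealP idX decr.
have exP n : exists k, `[< X n (m ^+ k) >].
  by exists n0; apply/asboolP; rewrite mn; have [] := idX n.
pose f n := ex_minn (exP n).
have fX n : X n (m ^+ f n).
  by rewrite /f; case: ex_minnP => k /asboolP.
have f_min n k : X n (m ^+ k) -> (f n <= k)%N.
  by move=> Xk; rewrite /f; case: ex_minnP => i _; apply; apply/asboolP.
have [n|n|N fN] := @bounded_stable f n0.
- exact/f_min/decr.
- by apply: f_min; rewrite mn; have [] := idX n.
exists N => n Nn; apply/seteqP; split=> x.
  move: n Nn x {fN} => n /subnK <-; elim: (n - N)%N => [//|j IH x].
  by rewrite addSn => /decr/IH.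
have [i [[u ->] [v xE]]] := mP x => Xx.
have {}Xx : X N (m ^+ i) by have [_ _ XM] := idX N; rewrite xE; exact: XM.
have [_ _ XM] := idX n; apply: (XM (m ^+ i)).
by rewrite -(subnKC (f_min _ _ Xx)) -(fN n Nn) exprD; exact: XM.
Qed.

End PowerChain.

Section Local.
Variable A : nzRingType.
Hypothesis local : forall a : A, invertible a \/ nilpotent a.
Implicit Types (a b c d m r s t u v x y : A).

Lemma nilpotentMr x a : nilpotent x -> nilpotent (x * a).
Proof.
move=> nx; have [[b [xab _]]|//] := local (x * a).
by move: xab; rewrite -mulrA => /right_invertible_nonnil.
Qed.

Lemma nilpotentMl x a : nilpotent x -> nilpotent (a * x).
Proof.
move=> nx; have [[b [_ bax]]|//] := local (a * x).
by move: bax; rewrite mulrA => /left_invertible_nonnil.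
Qed.

Hypothesis arith : arithmetical A.

(** If [x + y = 1] then [x] or [y] is invertible. *)
Lemma local_right_chain : right_chain A.
Proof.
move=> a b; have [x [y [xy [u au] [v bv]]]] := arith a b.
have [[w [xw _]]|/invertible1B] := local x.
  by right; exists (u * w); rewrite mulrA -au -mulrA xw mulr1.
have -> : 1 - x = y by rewrite -xy addrAC subrr add0r.
by move=> [w [yw _]]; left; exists (v * w); rewrite mulrA -bv -mulrA yw mulr1.
Qed.

Lemma nilpotentD x y : nilpotent x -> nilpotent y -> nilpotent (x + y).
Proof.
move=> nx ny; have [[u ->]|[u ->]] := local_right_chain x y.
  by rewrite -{1}[x]mulr1 -mulrDr; exact: nilpotentMr.
by rewrite -{2}[y]mulr1 -mulrDr; exact: nilpotentMr.
Qed.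

(** If [x = a x t] with [t] nilpotent then [x = a^k x t^k = 0]. *)
Lemma local_right_duo a x : divides_left x (a * x).
Proof.
have [//|[t xt]] := local_right_chain x (a * x).
have [[w [tw _]]|[k tk]] := local t.
  by exists w; rewrite {2}xt -!mulrA tw mulr1.
have xk i : x = a ^+ i * x * t ^+ i.
  elim: i => [|i IH]; first by rewrite mul1r mulr1.
  by rewrite {1}IH {1}xt exprSr exprS !mulrA.
by exists 0; rewrite (xk k) tk !mulr0.
Qed.

Lemma principal_ideal x : ideal (divides_left x).
Proof.
have [X0 XD XM] := principal_right_ideal x; split=> // _ a [u ->].
by have [v E] := local_right_duo a x; exists (v * u); rewrite mulrA E mulrA.
Qed.

Hypothesis acc : acc_ideals A.

(** The nilpotent elements form the maximal ideal, which is principal: take [m A]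
    maximal among the ideals [m A] with [m] nilpotent, any two of which are
    comparable. *)
Lemma local_generator : exists2 m, nilpotent m &
  forall x, nilpotent x -> divides_left m x.
Proof.
have [_ [m nm <-] mmax] : exists2 X, [set divides_left m | m in @nilpotent A] X &
    forall Y, [set divides_left m | m in @nilpotent A] Y -> X `<=` Y -> Y `<=` X.
  apply: (@acc_maximal _ _ (divides_left 0)) => //.
    by move=> _ [m _ <-]; exact: principal_ideal.
  by exists 0 => //; exists 1%N; rewrite expr1.
exists m => // x nx; have [//|[u mx]] := local_right_chain m x.
apply: (mmax (divides_left x)); first by exists x.
  by move=> _ [v ->]; exists (u * v); rewrite mulrA -mx.
by exists 1; rewrite mulr1.
Qed.

Lemma local_power m : nilpotent m ->
  (forall x, nilpotent x -> divides_left m x) ->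
  forall x, exists k u, invertible u /\ x = m ^+ k * u.
Proof.
move=> [n mn] mP x.
have split_at k : divides_left (m ^+ k) x \/
    exists i u, invertible u /\ x = m ^+ i * u.
  elim: k => [|k [[t xt]|]]; [by left; exists x; rewrite mul1r| |by right].
  have [ut|/mP[t' tE]] := local t; first by right; exists k, t.
  by left; exists t'; rewrite exprSr -mulrA -tE.
have [[t ->]|//] := split_at n; exists n, 1.
by rewrite mn !mul0r; split=> //; exists 1; rewrite mulr1.
Qed.

Lemma local_generated : nilpotently_generated A.
Proof.
have [m nm mP] := local_generator; have [n mn] := nm.
exists m, n; split=> // x; have [k [u [[w [uw _]] xE]]] := local_power nm mP x.
exists k; split; first by exists u.
by exists w; rewrite xE -mulrA uw mulr1.
Qed.

Hypothesis ce : centrally_essential A.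

(** Write [[a, x] = x r] and [x c = d] central and nonzero.  Then
    [x r c = [a, x c] = 0], so [r] cannot be invertible. *)
Lemma local_commutator a x : exists2 r, nilpotent r & a * x - x * a = x * r.
Proof.
have [->|/eqP x0] := pselect (x = 0).
  by exists 0; [exists 1%N; rewrite expr1|rewrite !mulr0 !mul0r subrr].
have [t axt] := local_right_duo a x.
have rE : a * x - x * a = x * (t - a) by rewrite mulrBr -axt.
exists (t - a) => //; have [[w [rw _]]|//] := local (t - a).
have [c [d [cc cd _ /eqP d0 dE]]] := ce x0; case: d0.
have : x * (t - a) * c = 0.
  by rewrite -rE mulrBl -!mulrA -(cc a) !mulrA -(mulrA a) dE cd subrr.
by rewrite -mulrA -cc -dE => /(congr1 ( *%R^~ w)); rewrite mul0r -!mulrA rw mulr1.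
Qed.

(** By the commutator formula [m t] is [t m] modulo [m^2 A], so
    [m A `<=` A m + m^k A] for every [k]. *)
Lemma local_left_generator m : nilpotent m ->
  (forall x, nilpotent x -> divides_left m x) ->
  forall b, exists a, m * b = a * m.
Proof.
move=> [n mn] mP b.
have step t : exists a s, m * t = a * m + m ^+ 2 * s.
  have [r /mP[s rE] E] := local_commutator t m; exists t, (- s).
  by rewrite mulrN expr2 -mulrA -rE -E opprB addrC subrK.
have approx k : exists a s, m * b = a * m + m ^+ k.+1 * s.
  elim: k => [|k [a [s ->]]]; first by exists 0, b; rewrite mul0r add0r expr1.
  have [a' [s' E]] := step s; exists (a + m ^+ k * a'), s'.
  by rewrite exprSr -mulrA E mulrDr mulrDl !mulrA -!exprSr addrA.
have [a [s ->]] := approx n; exists a.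
by rewrite exprS mn mulr0 mul0r addr0.
Qed.

Lemma local_generated_left : nilpotently_generated A^c.
Proof.
have [m nm mP] := local_generator; have [n mn] := nm.
have expc k : (m : A^c) ^+ k = (m ^+ k : A).
  by elim: k => [//|k IH]; rewrite exprS exprSr IH.
have left k b : exists a, m ^+ k * b = a * m ^+ k.
  elim: k b => [|k IH] b; first by exists b; rewrite mul1r mulr1.
  have [a E] := IH b; have [a' E'] := local_left_generator nm mP a.
  by exists a'; rewrite exprS -mulrA E mulrA E' -mulrA.
exists (m : A^c), n; rewrite expc; split=> // x.
have [k [u [[w [uw wu]] xE]]] := local_power nm mP x.
exists k; rewrite expc; split; first by have [a E] := left k u; exists a; rewrite xE E.
have [a E] := left k w; exists a.
by rewrite -[RHS]/(a * x) xE mulrA -E -mulrA wu mulr1.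
Qed.

End Local.

(** * Finite local rings *)

Section Finite.
Variable A : nzRingType.
Hypothesis fin : finite_ring A.

Lemma finite_ring_collision (f : nat -> A) : exists i j, (i < j)%N /\ f i = f j.
Proof.
apply: contrapT => inj; apply: infinite_nat.
rewrite -(preimage_setT f); apply: finite_preimage fin => i j _ _ fij.
have [ij|ji|//] := ltngtP i j; case: inj; first by exists i, j.
by exists j, i.
Qed.

Lemma finite_domain_local : (forall x y : A, x * y = 0 -> x = 0 \/ y = 0) ->
  forall a : A, invertible a \/ nilpotent a.
Proof.
move=> dom a; have [->|/eqP a0] := pselect (a = 0).
  by right; exists 1%N; rewrite expr1.
have [i [j [/subnKC <-]]] := finite_ring_collision (GRing.exp a).
set k := (j - _)%N; rewrite addSnnS exprD => aE.
have : a ^+ i * (1 - a ^+ k.+1) = 0 by rewrite mulrBr mulr1 -aE subrr.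
case/dom => [ai0|/subr0_eq ak]; first by right; exists i.
by left; exists (a ^+ k); rewrite -exprS -exprSr.
Qed.

Hypotheses (local : forall a : A, invertible a \/ nilpotent a).

(** Some positive integer vanishes in [A]; its prime factors cannot all be
    invertible. *)
Lemma finite_local_characteristic : exists2 p, prime p & nilpotent (p%:R : A).
Proof.
have [i [j [ij]]] := finite_ring_collision (fun n => n%:R).
move=> /eqP; rewrite eq_sym -subr_eq0 -natrB ?(ltnW ij) //.
have : (0 < j - i)%N by rewrite subn_gt0.
move: (j - i)%N => {i j ij}; elim/ltn_ind => n IH n0 /eqP n_eq0.
have n1 : (1 < n)%N.
  by case: n n_eq0 n0 {IH} => [|[|//]] // /eqP; rewrite oner_eq0.
have pr := pdiv_prime n1; have [[b [_ bp]]|np] := local (pdiv n)%:R; last first.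
  by exists (pdiv n).
apply: (IH (n %/ pdiv n)%N).
- by rewrite ltn_Pdiv // prime_gt1.
- by rewrite divn_gt0 ?pdiv_gt0 // pdiv_leq.
have nE : (pdiv n)%:R * (n %/ pdiv n)%:R = 0 :> A.
  by rewrite -natrM mulnC divnK ?pdiv_dvd.
by apply/eqP; rewrite -[LHS]mul1r -[X in X * _]bp -mulrA nE mulr0.
Qed.

Hypotheses (arith : arithmetical A) (acc : acc_ideals A).

(** The binomial formula for [(y + c) ^ p] with [c := x - y]: the middle terms are
    multiples of [p]. *)
Lemma frobenius_nilpotent p (x y : A) : prime p -> nilpotent (p%:R : A) ->
  GRing.comm x y -> nilpotent (x ^+ p - y ^+ p) -> nilpotent (x - y).
Proof.
move=> pr np cxy; set c := x - y => nxy.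
have cyc : GRing.comm y c.
  by apply: GRing.commrB => //; exact: GRing.commr_sym.
have [p' pE] : exists p', p = p'.+1 by exists p.-1; rewrite prednK ?prime_gt0.
have : x ^+ p = y ^+ p + \sum_(i < p') y ^+ (p - i.+1) * c ^+ i.+1 *+ 'C(p, i.+1)
    + c ^+ p.
  have -> : x = y + c by rewrite addrC subrK.
  rewrite exprDn_comm // pE big_ord_recl big_ord_recr /= /bump /=.
  by rewrite subn0 expr0 mulr1 bin0 subSS subnn expr0 mul1r binn addrA.
have mid : nilpotent (\sum_(i < p') y ^+ (p - i.+1) * c ^+ i.+1 *+ 'C(p, i.+1)).
  elim/big_ind: _ => [|u v|i _]; [by exists 1%N; rewrite expr1| |].
    exact: nilpotentD.
  have /dvdnP[q ->] : (p %| 'C(p, i.+1))%N.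
    by apply: prime_dvd_bin => //; rewrite /= pE ltnS ltn_ord.
  by rewrite mulrnA -mulr_natr; exact: nilpotentMl.
set S := \sum_(i < _) _ in mid * => xE; apply: (@nilpotent_exp _ _ p).
have -> : c ^+ p = (x ^+ p - y ^+ p) + S * -1.
  by rewrite xE mulrN1 -(addrA (y ^+ p)) [y ^+ p + _]addrC addrK [S + _]addrC addrK.
by apply: nilpotentD => //; exact: nilpotentMr.
Qed.

Lemma frobenius_nilpotentX p (x y : A) k : prime p -> nilpotent (p%:R : A) ->
  GRing.comm x y -> nilpotent (x ^+ (p ^ k) - y ^+ (p ^ k)) -> nilpotent (x - y).
Proof.
move=> pr np cxy; elim: k => [//|k IH]; rewrite expnSr !exprM => nxy.
apply: IH; apply: frobenius_nilpotent pr np _ nxy.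
by apply: GRing.commrX; apply/GRing.commr_sym/GRing.commrX/GRing.commr_sym.
Qed.

Hypothesis ce : centrally_essential A.

(** Commutators raise the [m]-adic degree, and so does [p]; hence raising to the
    [p]-th power brings [a] closer to the center: with [w := [a, x]], the
    commutator [[a^p, x]] is [p w a^(p-1)] up to higher degree.  So [a^(p^i)] is
    central for large [i].  By finiteness [a] is congruent to such a power
    modulo nilpotent elements, so that [A] is the center plus [m A].  Iterating,
    every element is a polynomial in [m] with central coefficients. *)
Theorem finite_local_commutative : commutative_ring A.
Proof.
have [m nm mP] := local_generator local arith acc; have [n mn] := nm.
have [p pr np] := finite_local_characteristic.
pose J i := divides_left (m ^+ i).
have idJ i : ideal (J i) by exact: principal_ideal.
have JD i x y : J i x -> J i y -> J i (x + y) by have [_ JD _ _] := idJ i; exact: JD.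
have JMr i x a : J i x -> J i (x * a) by have [_ _ JM _] := idJ i; exact: JM.
have JMl i x a : J i x -> J i (a * x) by have [_ _ _ MJ] := idJ i; exact: MJ.
have J_nil i w r : J i w -> nilpotent r -> J i.+1 (w * r).
  move=> [t ->] nr; have /mP[t' E] : nilpotent (t * r) by exact: nilpotentMl.
  by exists t'; rewrite exprSr -!mulrA E.
have J_comm i w a : J i w -> J i.+1 (a * w - w * a).
  by move=> Jw; have [r nr ->] := local_commutator local arith ce a w; exact: J_nil.
have pow i (a x : A) k : J i (a * x - x * a) -> exists2 j, J i.+1 j &
    a ^+ k.+1 * x - x * a ^+ k.+1 = (a * x - x * a) * a ^+ k *+ k.+1 + j.
  set w := a * x - x * a => Jw; elim: k => [|k [j Jj E]].
    by exists 0; [have [] := idJ i.+1|rewrite expr0 mulr1 addr0 !expr1].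
  exists ((a * w - w * a) * a ^+ k *+ k.+1 + a * j).
    apply: (JD); last exact: JMl.
    by rewrite -mulr_natr; apply/JMr/JMr/J_comm.
  have -> : a ^+ k.+2 * x - x * a ^+ k.+2 =
      a * (a ^+ k.+1 * x - x * a ^+ k.+1) + w * a ^+ k.+1.
    rewrite (exprS a k.+1) /w; move: (a ^+ k.+1) => P.
    by rewrite mulrBr mulrBl !mulrA addrA subrK.
  rewrite E mulrDr mulrnAr [(a * w - _) * _]mulrBl mulrnBl [RHS]addrA.
  rewrite [in RHS]mulrS exprS !mulrA -/w; move: (_ *+ _) (_ *+ _) => u v.
  by rewrite [LHS]addrAC; congr (_ + _); rewrite -addrA [u + _]addrC subrK addrC.
have powp i (a x : A) : J i (a * x - x * a) -> J i.+1 (a ^+ p * x - x * a ^+ p).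
  move=> Jw; have [j Jj E] := pow i a x p.-1 Jw.
  rewrite prednK ?prime_gt0 // in E; rewrite E -mulr_natr.
  by apply: JD => //; apply: J_nil => //; exact: JMr.
have cpow (a : A) i : (n <= i)%N -> central (a ^+ (p ^ i)).
  move=> ni x; have : J i (a ^+ (p ^ i) * x - x * a ^+ (p ^ i)).
    elim: i {ni} => [|i IH]; first by exists (a * x - x * a); rewrite mul1r expn0 expr1.
    by rewrite expnSr exprM; exact: powp.
  by move=> [t]; rewrite -(subnKC ni) exprD mn !mul0r => /subr0_eq.
have lift (a : A) : exists2 z, central z & nilpotent (a - z).
  have [i [j [ij E]]] := finite_ring_collision (fun i => a ^+ (p ^ (n * i))).
  exists (a ^+ (p ^ (n * (j - i)))).
    by apply: cpow; rewrite leq_pmulr // subn_gt0.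
  apply: (@frobenius_nilpotentX p _ _ (n * i)) => //; first exact: GRing.commrX.
  rewrite -exprM -expnD -mulnDr subnK ?(ltnW ij) // E subrr.
  by exists 1%N; rewrite expr1.
have digits (b : A) k (a : A) : GRing.comm b m ->
    exists q t, GRing.comm b q /\ a = q + m ^+ k * t.
  move=> bm; elim: k => [|k [q [t [bq ->]]]].
    by exists 0, a; rewrite mul1r add0r; split=> //; exact: GRing.commr0.
  have [z cz /mP[t' E]] := lift t; exists (q + m ^+ k * z), t'; split.
    apply: GRing.commrD => //; apply: GRing.commrM; first exact: GRing.commrX.
    exact/GRing.commr_sym/cz.
  by rewrite -addrA exprSr -mulrA -E -mulrDr [z + _]addrC subrK.
have comm_from (b : A) : GRing.comm b m -> central b.
  by move=> bm a; have [q [t [bq ->]]] := digits b n a bm; rewrite mn mul0r addr0.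
have cm : central m by apply: comm_from.
by move=> a b; apply: comm_from; exact/GRing.commr_sym/cm.
Qed.

End Finite.

(** * Dedekind domains *)

Section DomainStructure.
Variable A : nzRingType.
Hypothesis mulC : commutative_ring A.
Hypothesis dom : forall x y : A, x * y = 0 -> x = 0 \/ y = 0.

Let unit_pred : pred A := fun x => `[< exists y, y * x = 1 >].
Let inverse (x : A) : A :=
  if pselect (exists y, y * x = 1) is left H then projT1 (cid H) else x.

Let mulVr : {in unit_pred, left_inverse 1 inverse *%R}.
Proof.
move=> x /asboolP ux; rewrite /inverse; case: pselect => // H.
by case: cid.
Qed.

Let unitP (x y : A) : y * x = 1 -> unit_pred x.
Proof. by move=> yx; apply/asboolP; exists y. Qed.

Let inverse_out : {in [predC unit_pred], inverse =1 id}.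
Proof.
move=> x /asboolPn nx; rewrite /inverse; case: pselect => // H.
Qed.

Let integral (x y : A) : x * y = 0 -> (x == 0) || (y == 0).
Proof. by case/dom => ->; rewrite eqxx ?orbT. Qed.

Definition domain_comNzRing : comNzRingType :=
  HB.pack (GRing.NzRing.sort A) (GRing.PzRing_hasCommutativeMul.Build A mulC).

Definition domain_comUnitRing : comUnitRingType :=
  HB.pack (GRing.NzRing.sort A) domain_comNzRing
    (@GRing.ComNzRing_hasMulInverse.Build domain_comNzRing unit_pred inverse
       mulVr unitP inverse_out).

Definition domain_idomain : idomainType :=
  HB.pack (GRing.NzRing.sort A) domain_comUnitRing
    (@GRing.ComUnitRing_isIntegral.Build domain_comUnitRing integral).

Lemma ring_isomorphic_domain : ring_isomorphic A domain_idomain.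
Proof. by exists (GRing.RMorphism.clone A domain_idomain (@idfun A) _); exists id. Qed.

End DomainStructure.

Section Dedekind.
Variable D : idomainType.
Implicit Types (a b c d p q r s t u v w x y : D) (I J M P : set D).

Lemma fraction_quotient (z : {fraction D}) :
  exists n d, d != 0 /\ z = tofrac n / tofrac d.
Proof.
elim/quotW: z => x; exists \n_x, \d_x; split; first exact: denom_ratioP.
have d0 : tofrac \d_x != 0 by rewrite tofrac_eq0 denom_ratioP.
apply: (canRL (mulfK d0)).
rewrite -[LHS]/(FracField.mul _ _) !piE /FracField.mulf; apply/eqmodP => /=.
rewrite FracField.equivfE !numden_Ratio ?oner_eq0 ?mulr1 ?denom_ratioP //.
by rewrite mulrC.
Qed.

Lemma commutative_ideal P :
  P 0 -> (forall x y, P x -> P y -> P (x + y)) -> (forall x a, P x -> P (x * a)) ->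
  ideal P.
Proof. by move=> P0 PD PM; split=> // x a Px; rewrite mulrC; exact: PM. Qed.

Lemma idealr_closedP P : idealr_closed [in P] <-> ideal P /\ ~ P 1.
Proof.
split=> [[P0 P1 Plin]|[[P0 PD PM MP] P1]].
  have PD x y : P x -> P y -> P (x + y).
    move=> Px Py; have := Plin 1 _ _ (mem_set Px) (mem_set Py).
    by rewrite mul1r => /set_mem.
  split; last by move/mem_set => P1'; rewrite P1' in P1.
  split=> [|//|x a Px|x a Px]; first exact: set_mem P0.
    by have := Plin a _ _ (mem_set Px) P0; rewrite addr0 mulrC => /set_mem.
  by have := Plin a _ _ (mem_set Px) P0; rewrite addr0 => /set_mem.
split=> [||a u v /set_mem Pu /set_mem Pv]; first exact: mem_set.
  by apply/negP => /set_mem.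
by apply: mem_set; apply: PD => //; exact: MP.
Qed.

Lemma prime_idealP P : prime_idealr_closed [in P] <->
  forall x y, P (x * y) -> P x \/ P y.
Proof.
split=> [pr x y Pxy|pr x y /set_mem/pr].
  by have /orP[/set_mem|/set_mem] := pr x y (mem_set Pxy); [left|right].
by case=> [Px|Py]; rewrite ?(mem_set Px) ?(mem_set Py) ?orbT.
Qed.

Lemma comm_annihilator_stable L w0 : acc_ideals D -> ideal L ->
  exists k, forall t, L (w0 ^+ k.+1 * t) -> L (w0 ^+ k * t).
Proof.
move=> acc idL; have [k stab] := power_annihilators_stabilise w0 acc idL.
exists k => t Lt; apply: (stab 1%N) => r; rewrite addn1 mulrAC.
by have [_ _ LM _] := idL; exact: LM.
Qed.

Lemma divides_left_ideal d : ideal (divides_left d).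
Proof. by have [L0 LD LM] := principal_right_ideal d; exact: commutative_ideal. Qed.

(** Let [z = a / b] be a root of a monic polynomial of degree [n + 1], and
    [x + y = 1] with [z x] in [D] and [y = v z].  Multiplying the equation by
    [v ^ n] shows that [z y ^ n] lies in [D], and [1 - y ^ n] is a multiple of
    [x]. *)
Lemma arithmetical_integrally_closed : arithmetical D ->
  forall z : {fraction D}, integralOver (@tofrac D) z -> exists a, z = tofrac a.
Proof.
move=> arith z [p pmonic /eqP pz0].
have [a [b [b0 zE]]] := fraction_quotient z.
have bF0 : tofrac b != 0 by rewrite tofrac_eq0.
have [x [y [xy [u axE] [v byE]]]] := arith a b.
have zx : z * tofrac x = tofrac u.
  by rewrite zE mulrAC -tofracM axE tofracM mulrAC mulfV // mul1r.
have yE : tofrac y = tofrac v * z.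
  apply: (mulfI bF0); rewrite -tofracM byE tofracM zE [RHS]mulrCA.
  by rewrite [tofrac b * _]mulrC divfK // mulrC.
have in_image (q : {poly D}) n : (size q <= n.+1)%N ->
    exists d, tofrac v ^+ n * (map_poly (@tofrac D) q).[z] = tofrac d.
  move=> qn; exists (\sum_(i < n.+1) q`_i * v ^+ (n - i) * y ^+ i).
  rewrite (@horner_coef_wide _ n.+1) ?(leq_trans (size_poly _ _)) // mulr_sumr.
  rewrite rmorph_sum; apply: eq_bigr => i _; rewrite coef_map /=.
  have -> : tofrac v ^+ n = tofrac v ^+ (n - i) * tofrac v ^+ i.
    by rewrite -exprD subnK // -ltnS.
  by rewrite !tofracM !tofracXn yE exprMn; ring.
have [n sp] : exists n, size p = n.+2.
  case E : (size p) => [|[|n]]; last by exists n.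
    move/eqP: E; rewrite size_poly_eq0 => /eqP p0; move: pmonic.
    by rewrite p0 monicE lead_coef0 eq_sym oner_eq0.
  move: pz0; have /monicP := pmonic; rewrite lead_coefE E /= => p1.
  rewrite (size1_polyC (eq_leq E)) p1 map_polyC hornerC /= tofrac1.
  by move/eqP; rewrite oner_eq0.
have [d dE] : exists d, z * tofrac y ^+ n = tofrac d.
  have [|d] := in_image (p - 'X^(n.+1)) n.
    apply/leq_sizeP => j; rewrite leq_eqVlt => /predU1P[<-|nj].
      have /monicP := pmonic; rewrite lead_coefE sp /= => p1.
      by rewrite coefB coefXn eqxx p1 subrr.
    by rewrite coefB coefXn gtn_eqF // nth_default ?subr0 // sp.
  rewrite rmorphB /= map_polyXn hornerD hornerN hornerXn pz0 add0r => E.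
  by exists (- d); rewrite tofracN -E mulrN opprK yE exprMn mulrCA -exprS.
exists (d + u * \sum_(i < n) y ^+ i).
have geom : tofrac x * tofrac (\sum_(i < n) y ^+ i) = 1 - tofrac y ^+ n.
  rewrite -tofracM -tofracXn -tofrac1 -tofracB; congr tofrac.
  have -> : x = 1 - y by rewrite -xy addrK.
  by apply: oppr_inj; rewrite -mulNr !opprB -subrX1.
by rewrite tofracD -dE tofracM -zx -mulrA geom mulrBr mulr1 addrC subrK.
Qed.

(** If [P] is a nonzero prime, [p] is a nonzero element of [P] and [a] lies in
    [J] but not in [P], then comparing [a] with elements of [P] gives
    [p (1 - x) = a ^ k q] with [x], [q] in [P], and the chain condition puts
    some [1 - x] into [J]. *)
Lemma arithmetical_prime_maximal P J : acc_ideals D -> arithmetical D ->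
  idealr_closed [in P] -> prime_idealr_closed [in P] -> P <> [set 0] ->
  idealr_closed [in J] -> P `<=` J -> J = P.
Proof.
move=> acc arith /idealr_closedP[idP P1] /prime_idealP prP Pn0.
move=> /idealr_closedP[[J0 JD JM MJ] J1] PJ.
have [P0 PD PM MP] := idP.
apply/seteqP; split=> // a Ja; apply: contrapT => nPa.
have [p Pp p0] : exists2 p, P p & p != 0.
  apply: contrapT => none; apply: Pn0; apply/seteqP; split=> [q Pq|_ ->//].
  by apply: contrapT => /eqP q0; apply: none; exists q.
have primeP x y : P (x * y) -> ~ P x -> P y by move=> /prP[].
have divis k : exists x q, [/\ P x, P q & p * (1 - x) = a ^+ k * q].
  elim: k => [|k [x [q [Px Pq E]]]].
    by exists 0, p; rewrite subr0 mulr1 mul1r.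
  have [s [t [st [u asE] [w qtE]]]] := arith a q.
  have Ps : P s by apply: (primeP a) => //; rewrite asE; exact: PM.
  exists (x + s - x * s), w; split.
  - by apply: ideal_sub => //; [exact: PD|exact: PM].
  - by apply: (primeP a) => //; rewrite -qtE; exact: PM.
  have -> : p * (1 - (x + s - x * s)) = p * (1 - x) * (1 - s) by ring.
  by rewrite E exprSr -!mulrA -qtE -st addrAC subrr add0r.
have [k stab] := comm_annihilator_stable a acc (divides_left_ideal p).
have [x [q [Px Pq E]]] := divis k.+1.
have [|r akq] := stab q; first by exists (1 - x).
apply: J1; have -> : 1 = x + a * r.
  apply/eqP; rewrite addrC -subr_eq; apply/eqP; apply: (mulfI p0).
  by rewrite E exprS -mulrA akq mulrCA.
by apply: JD; [exact: PJ|exact: JM].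
Qed.

Lemma arithmetical_dedekind :
  arithmetical D -> noetherian_ring D -> dedekind_domain D.
Proof.
move=> arith noeth; split=> // [|P idP prP Pn0 J idJ PJ].
  exact: arithmetical_integrally_closed.
apply: arithmetical_prime_maximal => //; apply: noetherian_acc.
by left; case: noeth.
Qed.

End Dedekind.

Section DedekindArithmetical.
Variable D : idomainType.
Hypothesis acc : acc_ideals D.
Implicit Types (a b c d p q r s t u v w x y : D) (I J M P : set D).

Let dvd d x := divides_left (d : D) x.

Lemma maximal_ideal_above I : ideal I -> ~ I 1 ->
  exists M, [/\ ideal M, ~ M 1, I `<=` M & forall x y, M (x * y) -> M x \/ M y].
Proof.
move=> idI I1; pose F := [set M | [/\ ideal M, ~ M 1 & I `<=` M]].
have [M [idM M1 IM] maxM] : exists2 M, F M & forall Y, F Y -> M `<=` Y -> Y `<=` M.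
  by apply: (@acc_maximal _ _ I) => [|M []|] //; split.
exists M; split=> // x y Mxy; apply: contrapT => /not_orP[nMx nMy].
have [M0 MD MM _] := idM; pose Y := [set z | exists m r, M m /\ z = m + x * r].
have MY : M `<=` Y by move=> m Mm; exists m, 0; rewrite mulr0 addr0.
have [m [r [Mm one_eq]]] : Y 1.
  apply: contrapT => Y1; apply/nMx/(maxM Y) => //; last first.
    by exists 0, 1; rewrite add0r mulr1.
  split=> //; last exact: subset_trans IM MY.
  apply: commutative_ideal => [|_ _ [m [r [Mm ->]]] [n [t [Mn ->]]]|_ z [m [r [Mm ->]]]].
  - exact: MY.
  - by exists (m + n), (r + t); split; [exact: MD|ring].
  - by exists (m * z), (r * z); split; [exact: MM|ring].
apply: nMy; have -> : y = m * y + x * y * r by rewrite -[LHS]mul1r one_eq; ring.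
by apply: MD; exact: MM.
Qed.

(** Among the ideals [(c D : t)] contained in [M] a maximal one is prime. *)
Lemma associated_prime c M : ideal M -> ~ M 1 -> (forall x y, M (x * y) -> M x \/ M y) ->
  M c -> exists t, let Q := [set x | dvd c (x * t)] in
    [/\ ideal Q, Q `<=` M & forall x y, Q (x * y) -> Q x \/ Q y].
Proof.
move=> idM M1 prM Mc; have [M0 MD MM _] := idM.
have [c0 cD cM _] := divides_left_ideal c.
pose Q t := [set x | dvd c (x * t)].
have idQ t : ideal (Q t).
  apply: commutative_ideal => [|x y|x r] /=; rewrite /Q /= /dvd ?mul0r //.
    by rewrite mulrDl; exact: cD.
  by rewrite mulrAC; exact: cM.
pose F := [set X | exists2 t, X = Q t & Q t `<=` M].
have [_ [t -> QM] maxQ] : exists2 X, F X & forall Y, F Y -> X `<=` Y -> Y `<=` X.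
  apply: (@acc_maximal _ _ (Q 1)) => [//|_ [t -> _]|]; first exact: idQ.
  by exists 1 => // x; rewrite /Q /= mulr1 => -[r ->]; exact: MM.
exists t; split=> [||x y Qxy]; [exact: idQ|exact: QM|]; apply: contrapT => /not_orP[nQx nQy].
(* The element [s] outside [M] witnesses that [(c D : t y)] leaves [M]. *)
have [s nMs Qsy] : exists2 s, ~ M s & dvd c (s * (t * y)).
  apply: contrapT => none; apply: nQx; apply: (maxQ (Q (t * y))).
  - exists (t * y) => // s Qs; apply: contrapT => nMs; apply: none.
    by exists s.
  - by move=> r Qr; rewrite /Q /= mulrA; exact: cM.
  - by rewrite /Q /=; have -> : x * (t * y) = x * y * t by ring.
apply: nQy; apply: (maxQ (Q (t * s))).
- exists (t * s) => // r Qr; have /QM/prM[//|Ms] : Q t (r * s).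
    by rewrite /Q /= -mulrA [s * t]mulrC.
  by case: nMs.
- by move=> r Qr; rewrite /Q /= mulrA; exact: cM.
- by rewrite /Q /=; have -> : y * (t * s) = s * (t * y) by ring.
Qed.

(** If [z = t / c] satisfies [z M `<=` M] and [c \in M], then all [c z ^ k] lie in
    [D]; by the chain condition [z ^ k.+1] is a combination of smaller powers. *)
Lemma stable_fraction_integral c t M : c != 0 -> M c ->
  (forall x, M x -> exists2 y, M y & x * t = c * y) ->
  integralOver (@tofrac D) (tofrac t / tofrac c).
Proof.
move=> c0 Mc stable; set z := _ / _.
have cF0 : tofrac c != 0 by rewrite tofrac_eq0.
pose J k := [set d | exists2 p : {poly D}, (size p <= k)%N &
  tofrac d = tofrac c * (map_poly (@tofrac D) p).[z]].
have [k|k|N JN] := @acc J.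
- apply: commutative_ideal => [|x y [p pk xE] [q qk yE]|x a [p pk xE]].
  + by exists 0; rewrite ?size_poly0 // tofrac0 rmorph0 horner0 mulr0.
  + exists (p + q); first by rewrite (leq_trans (size_polyD _ _)) // geq_max pk.
    by rewrite tofracD rmorphD hornerD mulrDr -xE -yE.
  exists (p * a%:P); first by rewrite mulrC mul_polyC (leq_trans (size_scale_leq _ _)).
  by rewrite tofracM rmorphM /= map_polyC hornerM hornerC mulrA -xE.
- by move=> x [p pk xE]; exists p => //; exact: leqW.
have powz k : exists2 y, M y & tofrac c * z ^+ k = tofrac y.
  elim: k => [|k [y /stable[y' My' yt] yE]]; first by exists c; rewrite ?mulr1.
  exists y' => //; rewrite exprSr mulrA yE /z mulrA -tofracM yt tofracM mulrAC.
  by rewrite mulfV // mul1r.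
have [y _ yE] := powz N.
have [p pN] : J N y.
  rewrite -(JN N.+1 (leqnSn N)); exists 'X^N; first by rewrite size_polyXn.
  by rewrite map_polyXn hornerXn.
rewrite -yE => /(mulfI cF0) zE; exists ('X^N - p).
  by rewrite monicE lead_coefDl ?lead_coefXn // size_polyN size_polyXn ltnS.
by rewrite rootE rmorphB /= map_polyXn hornerD hornerN hornerXn zE subrr.
Qed.

(** Here [M = (c D : t)].  If [(t / c) M `<=` M] then [t / c] is integral, hence in
    [D], and [M] is not proper.  So [p t = c w] for some [p] in [M] and [w]
    outside [M]. *)
Lemma dedekind_locally_principal M : dedekind_domain D ->
  ideal M -> ~ M 1 -> (forall x y, M (x * y) -> M x \/ M y) -> (exists2 c, M c & c != 0) ->
  exists p w, [/\ M p, ~ M w & forall q, M q -> dvd p (q * w)].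
Proof.
move=> [_ intclosed dim1] idM M1 prM [c Mc c0].
have [t [idQ QM prQ]] := associated_prime idM M1 prM Mc.
set Q := [set x | _] in idQ QM prQ.
have Q1 : ~ Q 1 by move/QM.
have MQ : M = Q.
  apply: dim1 => //.
  - by apply/idealr_closedP; split.
  - exact/prime_idealP.
  - move=> Q0; have : Q c by exists t.
    by rewrite Q0 => /eqP; rewrite (negbTE c0).
  - exact/idealr_closedP.
have cross q p w r : q * t = c * r -> p * t = c * w -> q * w = p * r.
  by move=> qt pt; apply: (mulfI c0); rewrite mulrCA -pt mulrCA mulrA [RHS]mulrCA -qt; ring.
have [p [w [Mp nMw pt]]] : exists p w, [/\ M p, ~ M w & p * t = c * w].
  apply: contrapT => none; have stable x : M x -> exists2 y, M y & x * t = c * y.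
    move=> Mx; have [y xt] : Q x by rewrite -MQ.
    by exists y => //; apply: contrapT => nMy; apply: none; exists x, y.
  have /intclosed[a aE] := stable_fraction_integral c0 Mc stable.
  apply: Q1; exists a; rewrite mul1r; apply/eqP; rewrite -tofrac_eq tofracM -aE.
  by rewrite mulrC divfK // tofrac_eq0.
exists p, w; split=> // q; rewrite {1}MQ => -[r qt]; exists r; exact: cross.
Qed.

(** A local parameter [p] at [M]: up to factors outside [M], every nonzero element
    is a power of [p]. *)
Lemma dedekind_valuation M p w a : (forall x y, M (x * y) -> M x \/ M y) -> ideal M ->
  M p -> ~ M w -> (forall q, M q -> dvd p (q * w)) -> a != 0 ->
  exists k u, ~ M u /\ w ^+ k * a = u * p ^+ k.
Proof.
move=> prM idM Mp nMw Mpw a0; apply: contrapT => none.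
have divis k : exists q, w ^+ k * a = q * p ^+ k.
  elim: k => [|k [q E]]; first by exists a; rewrite mul1r mulr1.
  have [r qw] : dvd p (q * w).
    by apply: Mpw; apply: contrapT => nMq; apply: none; exists k, q.
  by exists r; rewrite exprS -mulrA E mulrA [w * q]mulrC qw exprS; ring.
have [k stab] := comm_annihilator_stable p acc (divides_left_ideal a).
have [q E] := divis k.+1.
have [|r pq] := stab q; first by exists (w ^+ k.+1); rewrite mulrC -E mulrC.
have Mwk : M (w ^+ k.+1).
  have -> : w ^+ k.+1 = p * r.
    by apply: (mulfI a0); rewrite mulrC E exprS mulrCA [q * _]mulrC pq mulrCA.
  by have [_ _ MM _] := idM; exact: MM.
elim: k.+1 Mwk => [|i IH]; last by rewrite exprS => /prM[].
have [_ _ MM _] := idM; rewrite expr0 => M1; apply: nMw.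
by rewrite -[w]mul1r; exact: MM.
Qed.

(** If the two colon ideals are not comaximal, they lie in a maximal ideal [M]; but
    at [M] both [a] and [b] are powers of [p] up to factors outside [M], so one divides the
    other after multiplication by some element outside [M]. *)
Theorem dedekind_arithmetical : dedekind_domain D -> arithmetical D.
Proof.
move=> ded a b.
have [->|/eqP a0] := pselect (a = 0).
  exists 1, 0; rewrite addr0 mul0r mulr0; split=> //; first by exists 0; rewrite mulr0.
  by exists 0; rewrite mul0r.
have [->|/eqP b0] := pselect (b = 0).
  exists 0, 1; rewrite add0r mul0r mulr0; split=> //; first by exists 0; rewrite mul0r.
  by exists 0; rewrite mulr0.
pose I := [set z | exists x y, [/\ x + y = z, dvd b (a * x) & dvd a (b * y)]].
suff : I 1 by [].
apply: contrapT => I1.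
have aD := divides_left_ideal a; have bD := divides_left_ideal b.
have idI : ideal I.
  have [a_0 a_D a_M _] := aD; have [b_0 b_D b_M _] := bD.
  apply: commutative_ideal.
  - by exists 0, 0; rewrite addr0 !mulr0; split.
  - move=> _ _ [x [y [<- ax by_]]] [x' [y' [<- ax' by']]].
    exists (x + x'), (y + y'); split; first by rewrite addrACA.
      by rewrite mulrDr; exact: b_D.
    by rewrite mulrDr; exact: a_D.
  move=> _ r [x [y [<- ax by_]]]; exists (x * r), (y * r).
  by split; [rewrite mulrDl|rewrite mulrA; exact: b_M|rewrite mulrA; exact: a_M].
have [M [idM M1 IM prM]] := maximal_ideal_above idI I1.
have [a_0 _ _ _] := aD; have [b_0 _ _ _] := bD.
have left x : dvd b (a * x) -> M x.
  by move=> ax; apply: IM; exists x, 0; rewrite addr0 mulr0; split.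
have right y : dvd a (b * y) -> M y.
  by move=> bdvd; apply: IM; exists 0, y; rewrite add0r mulr0; split.
have Mb : M b by apply: left; exists a; rewrite mulrC.
have [p [w [Mp nMw Mpw]]] : exists p w, [/\ M p, ~ M w & forall q, M q -> dvd p (q * w)].
  by apply: dedekind_locally_principal => //; exists b.
have [k [u [nMu aE]]] := dedekind_valuation prM idM Mp nMw Mpw a0.
have [l [v [nMv bE]]] := dedekind_valuation prM idM Mp nMw Mpw b0.
have nMwX i : ~ M (w ^+ i).
  by elim: i => [|i IH]; [rewrite expr0|rewrite exprS => /prM[]].
have mulN x y : ~ M x -> ~ M y -> ~ M (x * y) by move=> nx ny /prM[].
have [kl|/ltnW lk] := leqP k l.
- apply: (mulN _ _ nMu (nMwX l)); apply: right.
  exists (v * p ^+ (l - k) * w ^+ k).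
  have -> : b * (u * w ^+ l) = u * (w ^+ l * b) by ring.
  rewrite bE -[in p ^+ l](subnK kl) exprD.
  have -> : a * (v * p ^+ (l - k) * w ^+ k) = v * p ^+ (l - k) * (w ^+ k * a) by ring.
  by rewrite aE; ring.
apply: (mulN _ _ nMv (nMwX k)); apply: left.
exists (u * p ^+ (k - l) * w ^+ l).
have -> : a * (v * w ^+ k) = v * (w ^+ k * a) by ring.
rewrite aE -[in p ^+ k](subnK lk) exprD.
have -> : b * (u * p ^+ (k - l) * w ^+ l) = u * p ^+ (k - l) * (w ^+ l * b) by ring.
by rewrite bE; ring.
Qed.

End DedekindArithmetical.

(** * Uniserial Artinian rings are Noetherian *)

Section UniserialArtinian.
Variable A : nzRingType.
Hypothesis chain : right_chain A.
Implicit Types a b e q r s x y : A.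

Lemma right_chain_indecomposable : indecomposable A.
Proof.
move=> e ee; have ef : e * (1 - e) = 0 by rewrite mulrBr mulr1 ee subrr.
have fe : (1 - e) * e = 0 by rewrite mulrBl mul1r ee subrr.
have ff : (1 - e) * (1 - e) = 1 - e by rewrite mulrBr mulr1 fe subr0.
have [[u E]|[u E]] := chain e (1 - e).
  by right; apply/esym/subr0_eq; rewrite E -ee -mulrA -E.
by left; rewrite E -ff -mulrA -E fe.
Qed.

Lemma right_chain_invertible1B y : ~ invertible y -> invertible (1 - y).
Proof.
have idem := right_chain_indecomposable.
move=> ny; have [[u E]|[u E]] := chain y (1 - y).
  case: ny; apply: (indecomposable_invertible (b := 1 + u)) => //.
  by rewrite mulrDr mulr1 -E addrC subrK.
apply: (indecomposable_invertible (b := 1 + u)) => //.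
by rewrite mulrDr mulr1 -E subrK.
Qed.

(** In a strictly ascending chain of right ideals, elements [y k] of the
    successive differences satisfy [y k = y k.+1 * r k] with [r k] not
    invertible.  The left ideals generated by [r n ... r 0] descend; where they
    stabilise the product vanishes, so [y 0 = 0]. *)
Theorem chain_artinian_noetherian :
  artinian_module (left_regular A) -> right_noetherian_ring A.
Proof.
have idem := right_chain_indecomposable.
move=> art X /(_ _)/right_idealP idX incr.
apply: contrapT => /(@unstable_chain_sequence A _ incr)[idx [y [_ yX ynX]]].
have ndiv k : ~ divides_left (y k) (y k.+1).
  by move=> [u E]; apply: (ynX k.+1); rewrite E; have [_ _ XM] := idX (idx k.+1); exact: XM.
have quot k : exists r, y k = y k.+1 * r.
  by have [/ndiv|[r]] := chain (y k) (y k.+1); last exists r.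
have [r rE] := choice quot.
have nr k : ~ invertible (r k).
  by move=> [s [rs _]]; apply: (ndiv k); exists s; rewrite (rE k) -mulrA rs mulr1.
pose q n := iteri n (fun k p => r k * p) 1.
have yq n : y 0%N = y n * q n.
  by elim: n => [|n IH]; rewrite ?mulr1 // IH (rE n) -mulrA.
have [n|n x [u ->]|N /(_ N.+1 (leqnSn N)) qN] :=
  art (fun n => @divides_left A^c (q n)).
- exact/(@right_idealP A^c)/principal_right_ideal.
- by exists (@GRing.mul A u (r n)); exact: (@mulrA A).
have [s sE] : exists s : A, q N = s * (r N * q N).
  have [s sE] : @divides_left A^c (q N.+1) (q N) by rewrite qN; exists 1; rewrite mulr1.
  by exists s.
have [|w [_ wE]] := @right_chain_invertible1B (s * r N).
  move=> [b [_ bsr]]; apply: (nr N); exists (b * s); split; last by rewrite -mulrA.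
  by apply: indecomposable_inverse => //; rewrite -mulrA.
have q0 : q N = 0.
  by rewrite -[q N]mul1r -wE -mulrA mulrBl mul1r -mulrA -sE subrr mulr0.
by apply: (ynX 0%N); rewrite (yq N) q0 mulr0; have [] := idX (idx 0%N).
Qed.

End UniserialArtinian.

Lemma uniserial_artinian_noetherian (A : nzRingType) :
  uniserial_ring A -> artinian_ring A -> noetherian_ring A.
Proof.
move=> [/right_uniserialP rch /left_uniserialP lch] [rart lart]; split.
  exact: chain_artinian_noetherian.
by apply: (@chain_artinian_noetherian A^c).
Qed.

(** * Surjective homomorphisms and direct products *)

(** A bare function rather than a bundled morphism, so that the same map serves
    for the opposite rings. *)
Definition surjects_onto (A B : nzRingType) : Prop :=
  exists f : A -> B, [/\ forall x y, f (x + y) = f x + f y,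
    forall x y, f (x * y) = f x * f y, f 1 = 1 & forall y, exists x, f x = y].

Section Surjection.
Variables A B : nzRingType.
Hypothesis AB : surjects_onto A B.

Lemma surjects_onto_opposite : surjects_onto A^c B^c.
Proof.
have [f [fD fM f1 fS]] := AB.
by exists f; split=> // x y; exact: fM.
Qed.

Lemma surjects_onto_arithmetical : arithmetical A -> arithmetical B.
Proof.
have [f [fD fM f1 fS]] := AB => arith a b.
have [a' <-] := fS a; have [b' <-] := fS b.
have [x [y [xy [u au] [v bv]]]] := arith a' b'.
exists (f x), (f y); split; first by rewrite -fD xy.
  by exists (f u); rewrite -!fM au.
by exists (f v); rewrite -!fM bv.
Qed.

Lemma surjects_onto_noetherian : right_noetherian_ring A -> right_noetherian_ring B.
Proof.
have [f [fD fM f1 fS]] := AB => noeth X /(_ _)/right_idealP idX incr.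
have f0 : f 0 = 0 by apply: (addrI (f 0)); rewrite -fD !addr0.
have [n|n x|N NX] := noeth (fun n => f @^-1` X n).
- apply/right_idealP; have [X0 XD XM] := idX n.
  by split=> [|x y Xx Xy|x a Xx]; rewrite /= ?f0 ?fD ?fM //; [exact: XD|exact: XM].
- exact: incr.
exists N => n /NX nN; apply/seteqP; split=> y; have [x <-] := fS y => Xx.
  by have : (f @^-1` X N) x by rewrite -nN.
by have : (f @^-1` X n) x by rewrite nN.
Qed.

Lemma surjects_onto_acc : acc_ideals A -> acc_ideals B.
Proof.
have [f [fD fM f1 fS]] := AB => acc X idX incr.
have f0 : f 0 = 0 by apply: (addrI (f 0)); rewrite -fD !addr0.
have [n|n x|N NX] := acc (fun n => f @^-1` X n).
- have [X0 XD XM MX] := idX n.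
  by split=> [|x y Xx Xy|x a Xx|x a Xx];
    rewrite /= ?f0 ?fD ?fM //; [exact: XD|exact: XM|exact: MX].
- exact: incr.
exists N => n /NX nN; apply/seteqP; split=> y; have [x <-] := fS y => Xx.
  by have : (f @^-1` X N) x by rewrite -nN.
by have : (f @^-1` X n) x by rewrite nN.
Qed.

End Surjection.

Lemma isomorphic_surjects (A B : nzRingType) :
  ring_isomorphic A B -> surjects_onto A B /\ surjects_onto B A.
Proof.
move=> [f [g fK gK]]; split.
  by exists f; split; [exact: rmorphD|exact: rmorphM|exact: rmorph1|
    move=> y; exists (g y)].
exists g; split=> [x y|x y||y]; try apply: (can_inj fK).
- by rewrite rmorphD !gK.
- by rewrite rmorphM !gK.
- by rewrite gK rmorph1.
- by exists (f y).
Qed.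

Lemma surjects_onto_commutative (A B : nzRingType) :
  surjects_onto A B -> commutative_ring A -> commutative_ring B.
Proof.
move=> [f [fD fM f1 fS]] mulC x y.
by have [x' <-] := fS x; have [y' <-] := fS y; rewrite -!fM mulC.
Qed.

Lemma surjects_onto_distributive (A B : nzRingType) :
  surjects_onto A B -> distributive_ring A -> distributive_ring B.
Proof.
move=> AB [/right_distributiveP r /left_distributiveP l]; split.
  by apply/right_distributiveP; exact: surjects_onto_arithmetical r.
apply/left_distributiveP; apply: surjects_onto_arithmetical l.
exact: surjects_onto_opposite.
Qed.

Lemma surjects_onto_noetherian_ring (A B : nzRingType) :
  surjects_onto A B -> noetherian_ring A -> noetherian_ring B.
Proof.
move=> AB [r l]; split; first exact: surjects_onto_noetherian r.
by apply: (@surjects_onto_noetherian A^c B^c) l; exact: surjects_onto_opposite.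
Qed.

Section Product.
Variables (n : nat).
Implicit Types B : 'I_n.+1 -> nzRingType.

Lemma product_opposite B : surjects_onto (ring_prod (fun i => (B i)^c)) (ring_prod B)^c.
Proof. by exists id; split=> // y; exists y. Qed.

Lemma product_arithmetical B : (forall i, arithmetical (B i)) -> arithmetical (ring_prod B).
Proof.
move=> arith a b.
have pointwise (T : 'I_n.+1 -> Type) (P : forall i, T i -> Prop) :
    (forall i, exists x, P i x) -> exists x : forall i, T i, forall i, P i (x i).
  by move=> H; exists (fun i => projT1 (cid (H i))) => i; case: cid.
have [w wP] := pointwise _ (fun i w => [/\ w.1.1 + w.1.2 = 1,
  a i * w.1.1 = b i * w.2.1 & b i * w.1.2 = a i * w.2.2]) (fun i =>
  let: ex_intro x (ex_intro y (And3 xy (ex_intro u au) (ex_intro v bv))) :=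
    arith i (a i) (b i) in
  ex_intro _ (x, y, (u, v)) (And3 xy au bv)).
exists (fun i => (w i).1.1), (fun i => (w i).1.2); split.
- by apply: functional_extensionality_dep => i; have [] := wP i.
- by exists (fun i => (w i).2.1); apply: functional_extensionality_dep => i; have [] := wP i.
- by exists (fun i => (w i).2.2); apply: functional_extensionality_dep => i; have [] := wP i.
Qed.

Lemma product_noetherian B : (forall i, right_noetherian_ring (B i)) ->
  right_noetherian_ring (ring_prod B).
Proof.
move=> noeth X /(_ _)/right_idealP idX incr.
pose Y i k := [set b : B i | exists2 x : ring_prod B, X k x & x i = b].
have stable i : exists N, forall k, (N <= k)%N -> Y i k = Y i N.
  apply: noeth => k; last by move=> b [x Xx xb]; exists x => //; exact: incr.
  apply/right_idealP; have [X0 XD XM] := idX k.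
  split=> [|_ _ [x Xx <-] [y Xy <-]|_ a [x Xx <-]].
  - by exists 0.
  - by exists (x + y); [exact: XD|].
  exists (x * dfwith (0 : ring_prod B) i a : ring_prod B); first exact: XM.
  by rewrite -[LHS]/(x i * dfwith _ i a i) dfwithin.
have [N NP] := choice stable; pose M := \max_i N i; exists M => k Mk.
apply/seteqP; split=> x; last exact: ascending_mono.
move=> Xkx; have lift i : exists y : ring_prod B, X M y /\ y i = x i.
  have NM : (N i <= M)%N by exact: leq_bigmax.
  have : Y i k (x i) by exists x.
  by rewrite (NP i k (leq_trans NM Mk)) -(NP i M NM) => -[y Xy yx]; exists y.
have [y yP] := choice lift; have [X0 XD XM] := idX M.
pose e i : ring_prod B := fun j => (i == j)%:R.
have -> : x = \sum_i y i * e i.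
  apply: functional_extensionality_dep => j.
  have sumE (I : Type) (r : seq I) (F : I -> ring_prod B) :
      (\sum_(i <- r) F i) j = \sum_(i <- r) F i j.
    by elim/big_rec2: _ => // i u v _ <-.
  rewrite sumE (bigD1 j) //= big1 ?addr0 => [|i ij].
    by rewrite -[RHS]/(y j j * (j == j)%:R) eqxx mulr1; have [_ ->] := yP j.
  by rewrite -[LHS]/(y i j * (i == j)%:R) (negbTE ij) mulr0.
elim/big_ind: _ => [||i _]; [exact: X0|exact: XD|].
by apply: XM; have [] := yP i.
Qed.

Lemma product_distributive B : (forall i, distributive_ring (B i)) ->
  distributive_ring (ring_prod B).
Proof.
move=> dist; split.
  apply/right_distributiveP/product_arithmetical => i.
  by have [/right_distributiveP] := dist i.
apply/left_distributiveP/(surjects_onto_arithmetical (product_opposite B)).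
by apply: product_arithmetical => i; have [_ /left_distributiveP] := dist i.
Qed.

Lemma product_noetherian_ring B : (forall i, noetherian_ring (B i)) ->
  noetherian_ring (ring_prod B).
Proof.
move=> noeth; split; first by apply: product_noetherian => i; have [] := noeth i.
apply: (@surjects_onto_noetherian _ _ (product_opposite B)).
by apply: product_noetherian => i; have [] := noeth i.
Qed.

Lemma product_commutative B : (forall i, commutative_ring (B i)) ->
  commutative_ring (ring_prod B).
Proof. by move=> mulC x y; apply: functional_extensionality_dep => i; exact: mulC. Qed.

Lemma product_finite B : (forall i, finite_ring (B i)) -> finite_ring (ring_prod B).
Proof.
move=> fin; have enum i : exists s : seq (B i), forall b, b \in s.
  have /finite_seqP[s sE] := fin i; exists s => b.
  by have : [set: B i] b by []; rewrite sE.
pose s i := projT1 (cid (enum i)).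
have sP i (b : B i) : b \in s i by rewrite /s; case: cid.
pose N := (\max_i size (s i)).+1.
pose code (x : ring_prod B) : {ffun 'I_n.+1 -> 'I_N} :=
  [ffun i => inord (index (x i) (s i))].
have := @finite_finset {ffun 'I_n.+1 -> 'I_N} setT.
rewrite /finite_ring -(preimage_setT code); apply: finite_preimage => x y _ _ xy.
apply: functional_extensionality_dep => i.
have bound b : (index b (s i) < N)%N.
  by rewrite ltnS (leq_trans (index_size _ _)) // (leq_bigmax i).
have := congr1 (fun c : {ffun 'I_n.+1 -> 'I_N} => val (c i)) xy.
rewrite /= !ffunE !inordK // => E.
by rewrite -[x i](nth_index 0 (sP i _)) E (nth_index 0 (sP i _)).
Qed.

End Product.

(** * Decomposition along primitive idempotents *)

Section Corner.
Variables (A : nzRingType) (e : A).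
Hypotheses (ce : central e) (ee : e * e = e) (e0 : e != 0).
Implicit Types x y : A.

Definition corner_sort := {x : A | e * x == x}.

HB.instance Definition _ := Choice.copy corner_sort {x : A | e * x == x}.

Implicit Types u v w : corner_sort.

Let in_corner x : e * (e * x) == e * x.
Proof. by rewrite mulrA ee. Qed.

Definition to_corner x : corner_sort := exist _ (e * x) (in_corner x).

Let cornerE u : e * sval u = sval u.
Proof. by case: u => x /= /eqP. Qed.

Let mul_corner u x : e * (sval u * x) = sval u * x.
Proof. by rewrite mulrA cornerE. Qed.

Let add u v := to_corner (sval u + sval v).
Let opp u := to_corner (- sval u).
Let mul u v := to_corner (sval u * sval v).

Let addA : associative add.
Proof.
by move=> u v w; apply: val_inj; rewrite /= !mulrDr !mulrA !ee !cornerE addrA.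
Qed.

Let addC : commutative add.
Proof. by move=> u v; apply: val_inj; rewrite /= addrC. Qed.

Let add0 : left_id (to_corner 0) add.
Proof. by move=> u; apply: val_inj; rewrite /= mulr0 add0r cornerE. Qed.

Let addN : left_inverse (to_corner 0) opp add.
Proof.
by move=> u; apply: val_inj; rewrite /= mulrDr mulrA ee mulrN cornerE addNr mulr0.
Qed.

Definition corner_zmodType : zmodType :=
  HB.pack corner_sort (GRing.isZmodule.Build corner_sort addA addC add0 addN).

Let mulA : @associative corner_zmodType mul.
Proof.
by move=> u v w; apply: val_inj; rewrite /= !mul_corner -mulrA mul_corner mulrA.
Qed.

Let mul1l : @left_id corner_zmodType _ (to_corner 1) mul.
Proof. by move=> u; apply: val_inj; rewrite /= mulr1 mulrA ee cornerE. Qed.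

Let mul1r : @right_id _ corner_zmodType (to_corner 1) mul.
Proof. by move=> u; apply: val_inj; rewrite /= mulr1 mul_corner -ce cornerE. Qed.

Let mulDl : @left_distributive corner_zmodType corner_zmodType mul +%R.
Proof.
move=> u v w; apply: val_inj.
rewrite -[LHS]/(e * (e * (sval u + sval v) * sval w)).
rewrite -[RHS]/(e * (e * (sval u * sval w) + e * (sval v * sval w))).
by rewrite mulrDr !cornerE mulrDl !mul_corner.
Qed.

Let mulDr : @right_distributive corner_zmodType corner_zmodType mul +%R.
Proof.
move=> u v w; apply: val_inj.
rewrite -[LHS]/(e * (sval u * (e * (sval v + sval w)))).
rewrite -[RHS]/(e * (e * (sval u * sval v) + e * (sval u * sval w))).
by rewrite [e * (_ + sval w)]mulrDr !cornerE mulrDr !mul_corner.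
Qed.

Let one_neq0 : (to_corner 1 : corner_zmodType) != 0.
Proof.
by apply: contra e0 => /eqP/(congr1 sval)/=; rewrite mulr1 mulr0 => ->.
Qed.

Definition corner : nzRingType :=
  HB.pack corner_sort corner_zmodType
    (GRing.Zmodule_isNzRing.Build corner_zmodType mulA mul1l mul1r mulDl mulDr one_neq0).

Definition corner_proj x : corner := to_corner x.

Lemma corner_projD x y : corner_proj (x + y) = corner_proj x + corner_proj y.
Proof.
apply: val_inj; rewrite -[LHS]/(e * (x + y)) -[RHS]/(e * (e * x + e * y)).
by rewrite !mulrDr !mulrA ee.
Qed.

Lemma corner_projM x y : corner_proj (x * y) = corner_proj x * corner_proj y.
Proof. 
apply: val_inj; rewrite -[LHS]/(e * (x * y)) -[RHS]/(e * (e * x * (e * y))).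
by rewrite [e * y]ce !mulrA -[_ * e]ce !mulrA !ee.
Qed.

Lemma corner_projK (u : corner) : corner_proj (sval u) = u.
Proof. by apply: val_inj; rewrite -[LHS]/(e * sval u) cornerE. Qed.

Lemma corner_surjects : surjects_onto A corner.
Proof.
exists corner_proj; split=> // [x y|x y|u]; first exact: corner_projD.
  exact: corner_projM.
by exists (sval u); exact: corner_projK.
Qed.

Lemma corner_proj_central x : central x -> central (corner_proj x).
Proof. by move=> cx u; rewrite /GRing.comm -(corner_projK u) -!corner_projM cx. Qed.

Lemma corner_centrally_essential : centrally_essential A -> centrally_essential corner.
Proof.
move=> ceA u u0; have su0 : sval u != 0.
  apply: contra u0 => /eqP su; apply/eqP; rewrite -(corner_projK u) su.
  by apply: val_inj; rewrite -[RHS]/(e * 0) /= mulr0.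
have [c [d [cc cd _ d0 dE]]] := ceA _ su0.
have ud : u * corner_proj c = corner_proj d by rewrite -{1}(corner_projK u) -corner_projM dE.
have td0 : corner_proj d != 0.
  apply: contra d0 => /eqP/(congr1 sval); rewrite -[LHS]/(e * d) -[RHS]/(e * 0).
  by rewrite mulr0 -dE mulrA cornerE => ->.
exists (corner_proj c), (corner_proj d); split=> //; try exact: corner_proj_central.
by apply: contra td0 => /eqP tc; rewrite -ud tc mulr0.
Qed.

Lemma corner_indecomposable :
  (forall f, f * f = f -> e * f = f -> f = 0 \/ f = e) -> indecomposable corner.
Proof.
move=> prim u uu; have [||su|su] := prim (sval u).
- have := congr1 sval uu; rewrite -[LHS]/(e * (sval u * sval u)).
  by rewrite mulrA cornerE.
- exact: cornerE.
- left; rewrite -(corner_projK u) su.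
  by apply: val_inj; rewrite -[LHS]/(e * 0) -[RHS]/(e * 0).
right; rewrite -(corner_projK u) su; apply: val_inj.
by rewrite -[LHS]/(e * e) -[RHS]/(e * 1) mulr1.
Qed.

End Corner.

Section Primitive.
Variable A : nzRingType.
Hypotheses (ce : centrally_essential A) (acc : acc_ideals A).
Implicit Types (e f g x y : A) (s : seq A).

Definition primitive e : Prop :=
  [/\ e * e = e, e != 0 & forall f, f * f = f -> e * f = f -> f = 0 \/ f = e].

Let idem_central := idempotent_central ce.

(** The last clause, [x e = x] on each summand, makes the summands of two
    orthogonal idempotents orthogonal. *)
Let decomposed e := exists s, [/\ forall x, x \in s -> primitive x,
  pairwise (fun x y => x * y == 0) s, \sum_(x <- s) x = e
  & forall x, x \in s -> x * e = x].

Let decomposedD e f : e * e = e -> f * f = f -> e * f = 0 ->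
  decomposed e -> decomposed f -> decomposed (e + f).
Proof.
move=> ee ff ef [s [sp so se sE]] [t [tp to te tE]].
have fe : f * e = 0 by rewrite (idem_central ff).
exists (s ++ t); split=> [x| | |x].
- by rewrite mem_cat => /orP[/sp|/tp].
- rewrite pairwise_cat so to !andbT; apply/allrelP => x y xs yt.
  rewrite -(sE x xs) -(tE y yt) -(idem_central ff y) mulrA -(mulrA x) ef.
  by rewrite mulr0 mul0r.
- by rewrite big_cat /= se te.
rewrite mem_cat mulrDr => /orP[xs|xt].
  by rewrite -{2}(sE x xs) -mulrA ef mulr0 addr0 sE.
by rewrite -{1}(tE x xt) -mulrA fe mulr0 add0r tE.
Qed.

(** If some idempotent were not a sum of primitive ones, one with [(1 - e) A]
    maximal would split as [f + g] with both halves decomposed. *)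
Let decomposed_idempotent e : e * e = e -> decomposed e.
Proof.
move=> ee; apply: contrapT => nd.
pose F := [set divides_left (1 - e) | e in [set e | e * e = e /\ ~ decomposed e]].
have [_ [{nd}e [{}ee nd] <-] emax] : exists2 X, F X &
    forall Y, F Y -> X `<=` Y -> Y `<=` X.
  apply: (@acc_maximal _ _ (divides_left (1 - e))) => [//|_ [f [ff _] <-]|].
    have [L0 LD LM] := principal_right_ideal (1 - f); split=> // x a [u ->].
    exists (a * u); rewrite !mulrA; congr (_ * u).
    by rewrite mulrBr mulrBl mulr1 mul1r (idem_central ff).
  by exists e.
have e0 : e != 0.
  apply/negP => /eqP e0; apply: nd; exists [::]; split=> //.
  by rewrite big_nil e0.
have [f [ff ef f0 fe]] : exists f, [/\ f * f = f, e * f = f, f <> 0 & f <> e].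
  apply: contrapT => none; apply: nd; exists [:: e]; split=> [x| | |x] //.
  - rewrite inE => /eqP ->; split=> // f ff ef; apply: contrapT => /not_orP[f0 fe].
    by apply: none; exists f.
  - by rewrite big_seq1.
  - by rewrite inE => /eqP ->.
have sub h : h * h = h -> e * h = h -> h <> e -> decomposed h.
  move=> hh eh he; apply: contrapT => ndh.
  have /emax/(_ _ (1 - h)) : F (divides_left (1 - h)) by exists h.
  case.
  - move=> _ [u ->]; exists ((1 - e) * u); rewrite mulrA; congr (_ * u).
    by rewrite mulrBr mulr1 mulrBl mul1r -(idem_central ee h) eh opprB addrA subrK.
  - by exists 1; rewrite mulr1.
  move=> u hE; apply: he; apply/esym/subr0_eq.
  have : e * (1 - h) = 0 by rewrite hE mulrA mulrBr mulr1 ee subrr mul0r.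
  by rewrite mulrBr mulr1 eh.
have fg : f * (e - f) = 0 by rewrite mulrBr ff (idem_central ff e) ef subrr.
have gg : (e - f) * (e - f) = e - f.
  by rewrite mulrBl fg subr0 mulrBr ee ef.
apply: nd; rewrite -[e](subrK f) addrC; apply: decomposedD => //.
  exact: sub.
apply: sub => //; first by rewrite mulrBr ee ef.
by move=> /eqP; rewrite -subr_eq0 addrAC subrr add0r oppr_eq0 => /eqP.
Qed.

Theorem primitive_decomposition : exists (n : nat) (E : 'I_n.+1 -> A),
  [/\ forall i, primitive (E i), forall i j, i != j -> E i * E j = 0
    & \sum_i E i = 1].
Proof.
have [[|x s] [sp so s1 _]] := decomposed_idempotent (mulr1 1).
  by move/eqP: s1; rewrite big_nil eq_sym oner_eq0.
exists (size s), (fun i => nth 0 (x :: s) i); split=> [i|i j ij|].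
- by apply/sp/mem_nth; rewrite ltn_ord.
- wlog lt_ij : i j ij / (i < j)%N => [wl|].
    have [lt_ij|lt_ji|/val_inj E] := ltngtP i j; first exact: wl.
      have [pp _ _] : primitive (nth 0 (x :: s) j) by apply/sp/mem_nth; rewrite ltn_ord.
      by rewrite -(idem_central pp) wl // eq_sym.
    by rewrite E eqxx in ij.
  by apply/eqP/(pairwiseP 0 so); rewrite // inE /= ltnS -ltnS ltn_ord.
by rewrite -s1 [RHS](big_nth 0) big_mkord.
Qed.

End Primitive.

(** The inverse isomorphism adds up the components. *)
Lemma corner_decomposition (A : nzRingType) n (E : 'I_n.+1 -> A)
    (cE : forall i, central (E i)) (EE : forall i, E i * E i = E i)
    (E0 : forall i, E i != 0) :
  (forall i j, i != j -> E i * E j = 0) -> \sum_i E i = 1 ->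
  ring_isomorphic A (ring_prod (fun i => corner (cE i) (EE i) (E0 i))).
Proof.
move=> orth sumE; pose B i := corner (cE i) (EE i) (E0 i).
pose f (x : A) : ring_prod B := fun i => corner_proj (cE i) (EE i) (E0 i) x.
have fD x y : f (x + y) = f x + f y.
  by apply: functional_extensionality_dep => i; exact: corner_projD.
have fM x y : f (x * y) = f x * f y.
  by apply: functional_extensionality_dep => i; exact: corner_projM.
have f0 : f 0 = 0 by apply: (addrI (f 0)); rewrite -fD !addr0.
have fB : zmod_morphism f.
  by move=> x y; apply: (addIr (f y)); rewrite -fD !subrK.
have f1 : monoid_morphism f by split.
pose F : {rmorphism A -> ring_prod B} := HB.pack f
  (GRing.isZmodMorphism.Build _ _ f fB) (GRing.isMonoidMorphism.Build _ _ f f1).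
exists F; exists (fun y : ring_prod B => \sum_i sval (y i)) => [x|y].
  by rewrite -[RHS]mul1r -sumE mulr_suml.
apply: functional_extensionality_dep => j; apply: val_inj.
rewrite -[LHS]/(E j * \sum_i sval (y i)) mulr_sumr (bigD1 j) //=.
have yE i : E i * sval (y i) = sval (y i) by case: (y i) => x /= /eqP.
rewrite yE big1 ?addr0 // => i ij.
by rewrite -yE mulrA orth ?mul0r // eq_sym.
Qed.

(** * A non-commutative uniserial Artinian centrally essential ring *)

Definition derivation (R : comNzRingType) (D : R -> R) : Prop :=
  (forall x y, D (x + y) = D x + D y) /\ forall x y, D (x * y) = D x * y + x * D y.

Lemma derivation0 (R : comNzRingType) (D : R -> R) : derivation D -> D 0 = 0.
Proof. by move=> [DD _]; apply: (addrI (D 0)); rewrite -DD !addr0. Qed.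

Lemma derivation1 (R : comNzRingType) (D : R -> R) : derivation D -> D 1 = 0.
Proof.
by move=> [_ DM]; apply: (addrI (D 1)); rewrite addr0 -{3}[1]mulr1 DM mulr1 mul1r.
Qed.

Section CocycleExtension.
Variables (F : fieldType) (D1 D2 : F -> F).
Hypotheses (der1 : derivation D1) (der2 : derivation D2).

Definition cocycle_sort : Type := (F * F)%type.
HB.instance Definition _ := GRing.Zmodule.copy cocycle_sort (F * F)%type.
Implicit Types u v w : cocycle_sort.

(** The extension of [F] by a square-zero ideal [F] that corresponds to the
    Hochschild cocycle [(a, b) |-> D1 a * D2 b]. *)
Let mul u v : cocycle_sort :=
  (u.1 * v.1, u.1 * v.2 + u.2 * v.1 + D1 u.1 * D2 v.1).

Let cmulA : associative mul.
Proof.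
have [DD1 DM1] := der1; have [DD2 DM2] := der2.
by move=> [a a'] [b b'] [c c']; congr (_, _) => /=; rewrite ?DM1 ?DM2; ring.
Qed.

Let cmul1l : left_id ((1, 0) : cocycle_sort) mul.
Proof. by move=> [a a']; congr (_, _) => /=; rewrite ?(derivation1 der1); ring. Qed.

Let cmul1r : right_id ((1, 0) : cocycle_sort) mul.
Proof. by move=> [a a']; congr (_, _) => /=; rewrite ?(derivation1 der2); ring. Qed.

Let cmulDl : left_distributive mul +%R.
Proof.
have [DD1 _] := der1.
by move=> [a a'] [b b'] [c c']; congr (_, _) => /=; rewrite ?DD1; ring.
Qed.

Let cmulDr : right_distributive mul +%R.
Proof.
have [DD2 _] := der2.
by move=> [a a'] [b b'] [c c']; congr (_, _) => /=; rewrite ?DD2; ring.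
Qed.

Let one_neq0 : ((1, 0) : cocycle_sort) != 0.
Proof. by apply/eqP => /(congr1 fst)/eqP; rewrite /= oner_eq0. Qed.

Definition cocycle_ring : nzRingType :=
  HB.pack cocycle_sort
    (GRing.Zmodule_isNzRing.Build cocycle_sort cmulA cmul1l cmul1r cmulDl cmulDr one_neq0).

Definition cocycle_elt (a b : F) : cocycle_ring := (a, b).
Local Notation elt := cocycle_elt.

Lemma cocycle_mulE (a b c d : F) :
  elt a b * elt c d = elt (a * c) (a * d + b * c + D1 a * D2 c).
Proof. by []. Qed.

Lemma cocycle_right_inverse a b : a != 0 -> exists v : cocycle_ring, elt a b * v = 1.
Proof.
move=> a0; exists (elt a^-1 (- (b * a^-1 + D1 a * D2 a^-1) / a)).
by apply: etrans (cocycle_mulE _ _ _ _) _; congr (_, _); field.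
Qed.

Lemma cocycle_left_inverse a b : a != 0 -> exists v : cocycle_ring, v * elt a b = 1.
Proof.
move=> a0; exists (elt a^-1 (- (a^-1 * b + D1 a^-1 * D2 a) / a)).
by apply: etrans (cocycle_mulE _ _ _ _) _; congr (_, _); field.
Qed.

Lemma cocycle_soc_mul b c d : elt 0 b * elt c d = elt 0 (b * c).
Proof. by rewrite cocycle_mulE (derivation0 der1); congr (_, _); ring. Qed.

Lemma cocycle_mul_soc b c d : elt c d * elt 0 b = elt 0 (b * c).
Proof. by rewrite cocycle_mulE (derivation0 der2); congr (_, _); ring. Qed.

(** The powers of [m := (0, 1)] generate: elements with nonzero first component are
    invertible, and the others are [m (b, 0)]. *)
Lemma cocycle_generated : nilpotently_generated cocycle_ring.
Proof.
exists (elt 0 1), 2%N; rewrite expr2 cocycle_soc_mul mulr0; split=> // -[a b].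
have [->|/eqP a0] := pselect (a = 0); last first.
  exists 0%N; rewrite expr0; split; first by exists (elt a b); rewrite mul1r.
  by have [v vE] := cocycle_right_inverse b a0; exists v.
have [->|/eqP b0] := pselect (b = 0).
  by exists 2%N; rewrite expr2 cocycle_soc_mul mulr0; split; exists 0; rewrite mulr0.
exists 1%N; rewrite expr1; split.
  by exists (elt b 0); rewrite cocycle_soc_mul mul1r.
by exists (elt b^-1 0); rewrite cocycle_soc_mul divff.
Qed.

Lemma cocycle_generated_left : nilpotently_generated cocycle_ring^c.
Proof.
have sq0 : (elt 0 1 : cocycle_ring^c) ^+ 2 = 0.
  by rewrite expr2 -[LHS]/(elt 0 1 * elt 0 1) cocycle_soc_mul mulr0.
exists (elt 0 1), 2%N; split=> // -[a b].
have [->|/eqP a0] := pselect (a = 0); last first.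
  exists 0%N; rewrite expr0; split; first by exists (elt a b); rewrite mul1r.
  by have [v vE] := cocycle_left_inverse b a0; exists v; exact: esym vE.
have [->|/eqP b0] := pselect (b = 0).
  by exists 2%N; rewrite sq0; split; exists 0; rewrite mulr0.
exists 1%N; rewrite expr1; split.
  by exists (elt b 0); rewrite -[RHS]/(elt b 0 * elt 0 1) cocycle_mul_soc mul1r.
by exists (elt b^-1 0); rewrite -[RHS]/(elt b^-1 0 * elt 0 b) cocycle_mul_soc divff.
Qed.

(** The ideal [0 * F] is central, and it contains [(a, b) (0, 1) = (0, a)]. *)
Lemma cocycle_centrally_essential : centrally_essential cocycle_ring.
Proof.
have csoc b : central (elt 0 b).
  by move=> [c d]; rewrite /GRing.comm cocycle_soc_mul cocycle_mul_soc.
have elt_neq0 b : b != 0 -> elt 0 b != 0.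
  by move=> b0; apply: contra b0 => /eqP/(congr1 snd)/= ->.
move=> [a b] ab0; have [a0|/eqP a0] := pselect (a = 0).
  exists 1, (elt a b); split=> //; first by move=> x; exact/GRing.commr_sym/GRing.commr1.
  by rewrite a0.
exists (elt 0 1), (elt 0 a); split=> //; try exact: elt_neq0.
  by apply: elt_neq0; exact: oner_neq0.
by rewrite cocycle_mul_soc mul1r.
Qed.

Lemma cocycle_noncommutative a b :
  D1 a * D2 b != D1 b * D2 a -> ~ commutative_ring cocycle_ring.
Proof.
move=> /eqP ab mulC; apply: ab; have := mulC (elt a 0) (elt b 0).
by rewrite !cocycle_mulE => /(congr1 snd); rewrite /= !mulr0 !mul0r !add0r.
Qed.

End CocycleExtension.

Section QuotientRule.
Variable K : fieldType.
Variables n d n' d' Dn Dd Dn' Dd' : K.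
Hypotheses (d0 : d != 0) (d'0 : d' != 0).

Lemma quotient_ruleD :
  ((Dn * d' + n * Dd' + (Dn' * d + n' * Dd)) * (d * d') -
   (n * d' + n' * d) * (Dd * d' + d * Dd')) / (d * d') ^+ 2 =
  (Dn * d - n * Dd) / d ^+ 2 + (Dn' * d' - n' * Dd') / d' ^+ 2.
Proof. by field; rewrite d0 d'0. Qed.

Lemma quotient_ruleM :
  ((Dn * n' + n * Dn') * (d * d') - (n * n') * (Dd * d' + d * Dd')) / (d * d') ^+ 2 =
  (Dn * d - n * Dd) / d ^+ 2 * (n' / d') + n / d * ((Dn' * d' - n' * Dd') / d' ^+ 2).
Proof. by field; rewrite d0 d'0. Qed.

End QuotientRule.

(** The quotient rule is independent of the representing fraction. *)
Lemma derivation_fraction (R : idomainType) (D : R -> R) : derivation D ->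
  exists2 D' : {fraction R} -> {fraction R}, derivation D' &
    forall a, D' (tofrac a) = tofrac (D a).
Proof.
move=> der; have [DD DM] := der.
have quot (z : {fraction R}) : exists w, forall n d, d != 0 -> z = tofrac n / tofrac d ->
    w = tofrac (D n * d - n * D d) / tofrac d ^+ 2.
  have [n0 [d0 [d0_neq0 zE]]] := fraction_quotient z.
  exists (tofrac (D n0 * d0 - n0 * D d0) / tofrac d0 ^+ 2) => n d d_neq0 zE'.
  have d0F : tofrac d0 != 0 by rewrite tofrac_eq0.
  have dF : tofrac d != 0 by rewrite tofrac_eq0.
  have nd : n * d0 = n0 * d.
    apply/eqP; rewrite -tofrac_eq !tofracM -eqr_div //; apply/eqP.
    by rewrite -zE -zE'.
  have := congr1 D nd; rewrite !DM => Dnd.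
  apply/eqP; rewrite eqr_div ?expf_neq0 // -!tofracXn -!tofracM tofrac_eq; apply/eqP.
  have -> : (D n * d - n * D d) * d0 ^+ 2 =
    (D n * d0 + n * D d0) * d * d0 - (n * d0) * d * D d0 - (n * d0) * D d * d0 by ring.
  by rewrite Dnd nd; ring.
have [D' D'E] := choice quot.
have D'frac n d : d != 0 ->
    D' (tofrac n / tofrac d) = tofrac (D n * d - n * D d) / tofrac d ^+ 2.
  by move=> d0; exact: D'E.
exists D'; last first.
  move=> a; rewrite -[tofrac a]divr1 -tofrac1 D'frac ?oner_neq0 //.
  by rewrite (derivation1 der) mulr0 subr0 mulr1 tofrac1 expr1n divr1.
split=> x y; have [n [d [d0 xE]]] := fraction_quotient x;
  have [n' [d' [d'0 yE]]] := fraction_quotient y;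
  have dF : tofrac d != 0 by rewrite tofrac_eq0.
  have d'F : tofrac d' != 0 by rewrite tofrac_eq0.
  have -> : x + y = tofrac (n * d' + n' * d) / tofrac (d * d').
    by rewrite xE yE addf_div // -!tofracM -tofracD.
  rewrite D'frac ?mulf_neq0 // xE yE !D'frac // !(DD, DM) !(tofracD, tofracN, tofracM).
  exact: quotient_ruleD.
have d'F : tofrac d' != 0 by rewrite tofrac_eq0.
have -> : x * y = tofrac (n * n') / tofrac (d * d').
  by rewrite xE yE mulf_div -!tofracM.
rewrite D'frac ?mulf_neq0 // xE yE !D'frac // !DM !(tofracD, tofracN, tofracM).
exact: quotient_ruleM.
Qed.

(** The cocycle built from the two partial derivatives of [rat(X, Y)]: the
    commutator of the two variables is the nonzero element [(0, 1)]. *)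
Theorem noncommutative_example : exists A : nzRingType,
  [/\ uniserial_ring A, artinian_ring A, centrally_essential A & ~ commutative_ring A].
Proof.
pose R := {poly {poly rat}}.
pose d2 (p : R) : R := p^`(); pose d1 (p : R) : R := swapXY (swapXY p)^`().
have der2 : derivation d2 by split=> p q; [exact: derivD|exact: derivM].
have der1 : derivation d1.
  split=> p q; rewrite /d1; first by rewrite rmorphD derivD rmorphD.
  by rewrite rmorphM derivM rmorphD !rmorphM /= !swapXYK.
have [D1 derD1 D1E] := derivation_fraction der1.
have [D2 derD2 D2E] := derivation_fraction der2.
exists (cocycle_ring derD1 derD2).
have gen := cocycle_generated derD1 derD2.
have gen_left := cocycle_generated_left derD1 derD2.
split; first split.
- by apply/right_uniserialP; exact: nilpotently_generated_chain.
- by apply/left_uniserialP; exact: nilpotently_generated_chain.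
- by split; [exact: nilpotently_generated_artinian|
             exact: (nilpotently_generated_artinian gen_left)].
- exact: cocycle_centrally_essential.
apply: (@cocycle_noncommutative _ _ _ derD1 derD2 (tofrac ('X%:P : R)) (tofrac ('X : R))).
rewrite !D1E !D2E -!tofracM tofrac_eq /d1 /d2 swapXY_Y swapXY_X !derivX !derivC.
by rewrite rmorph1 rmorph0 mul1r mul0r oner_neq0.
Qed.

(** * The structure theorem *)

(** An unstable chain would give an injective sequence of elements. *)
Lemma finite_acc (A : nzRingType) : finite_ring A -> acc_ideals A.
Proof.
move=> fin X _ incr; apply: contrapT => /(unstable_chain_sequence incr).
move=> [idx [y [idxS yX ynX]]].
have [i [j [ij yij]]] := finite_ring_collision fin y.
apply: (ynX j); rewrite -yij; apply: (ascending_mono incr _ (yX i)).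
exact: (homo_leq leqnn leq_trans idxS).
Qed.

Lemma commutative_acc_noetherian (A : nzRingType) :
  commutative_ring A -> acc_ideals A -> right_noetherian_ring A.
Proof.
move=> mulC acc X /(_ _)/right_idealP idX incr; apply: acc => // n.
have [X0 XD XM] := idX n; split=> // x a Xx.
by rewrite (mulC a); exact: XM.
Qed.

Lemma commutative_surjects_opposite (A : nzRingType) :
  commutative_ring A -> surjects_onto A A^c.
Proof.
by move=> mulC; exists id; split=> // y; exists y.
Qed.

Lemma commutative_domain_dedekind (A : nzRingType) : commutative_ring A ->
  (forall x y : A, x * y = 0 -> x = 0 \/ y = 0) -> arithmetical A -> acc_ideals A ->
  is_dedekind_domain A.
Proof.
move=> mulC dom arith acc; have iso := ring_isomorphic_domain mulC dom.
exists (domain_idomain mulC dom); split=> //.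
have [AD _] := isomorphic_surjects iso.
apply: arithmetical_dedekind; first exact: surjects_onto_arithmetical arith.
apply: (surjects_onto_noetherian_ring AD).
have noeth := commutative_acc_noetherian mulC acc; split=> //.
apply: (@surjects_onto_noetherian A A^c) noeth.
exact: commutative_surjects_opposite.
Qed.

Lemma dedekind_distributive_noetherian (A : nzRingType) :
  is_dedekind_domain A -> distributive_ring A /\ noetherian_ring A.
Proof.
move=> [D [/isomorphic_surjects[_ DA] ded]].
have [noeth _ _] := ded; split; last exact: surjects_onto_noetherian_ring noeth.
have arith : arithmetical D.
  by apply: dedekind_arithmetical ded; apply: noetherian_acc; left; case: noeth.
apply: (surjects_onto_distributive DA); split; first exact/right_distributiveP.
apply/left_distributiveP; apply: (surjects_onto_arithmetical _ arith).
by apply: commutative_surjects_opposite => x y; exact: mulrC.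
Qed.

Lemma uniserial_distributive (A : nzRingType) : uniserial_ring A -> distributive_ring A.
Proof.
move=> [/right_uniserialP r /left_uniserialP l].
by split; [apply/right_distributiveP|apply/left_distributiveP];
  exact: right_chain_arithmetical.
Qed.

Lemma local_uniserial_artinian (A : nzRingType) :
  (forall a : A, invertible a \/ nilpotent a) -> arithmetical A -> acc_ideals A ->
  centrally_essential A -> uniserial_ring A /\ artinian_ring A.
Proof.
move=> local arith acc ce.
have gen := local_generated local arith acc.
have gen_left := local_generated_left local arith acc ce.
split; split.
- by apply/right_uniserialP; exact: nilpotently_generated_chain.
- by apply/left_uniserialP; exact: nilpotently_generated_chain.
- exact: nilpotently_generated_artinian.
exact: (nilpotently_generated_artinian gen_left).
Qed.

(** Quantifying over all indecomposable factors lets both parts of the structure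
    theorem share one decomposition. *)
Lemma indecomposable_factors (A : nzRingType) (P : nzRingType -> Prop) :
  arithmetical A -> acc_ideals A -> centrally_essential A ->
  (forall B : nzRingType, surjects_onto A B -> arithmetical B -> acc_ideals B ->
     centrally_essential B -> indecomposable B -> P B) ->
  exists (n : nat) (B : 'I_n.+1 -> nzRingType),
    ring_isomorphic A (ring_prod B) /\ forall i, P (B i).
Proof.
move=> arith acc ce PB.
have [n [E [prim orth sumE]]] := primitive_decomposition ce acc.
have EE i : E i * E i = E i by case: (prim i).
have E0 i : E i != 0 by case: (prim i).
have cE i : central (E i) := idempotent_central ce (EE i).
exists n, (fun i => corner (cE i) (EE i) (E0 i)); split.
  exact: corner_decomposition.
move=> i; have sur := corner_surjects (cE i) (EE i) (E0 i); apply: PB => //.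
- exact: surjects_onto_arithmetical arith.
- exact: surjects_onto_acc acc.
- exact: corner_centrally_essential.
by apply: corner_indecomposable; case: (prim i).
Qed.

Lemma surjects_onto_finite (A B : nzRingType) :
  surjects_onto A B -> finite_ring A -> finite_ring B.
Proof.
move=> [f [_ _ _ fS]] /(finite_image f); apply: sub_finite_set => y _.
by have [x <-] := fS y; exists x.
Qed.

Theorem theorem1p2 :
  (* (1) *)
  [/\ forall A : nzRingType,
        right_distributive_ring A -> centrally_essential A -> finite_ring A ->
        [/\ exists (n : nat) (B : 'I_n.+1 -> nzRingType),
              ring_isomorphic A (ring_prod B) /\
              (forall i, [/\ commutative_ring (B i), uniserial_ring (B i)
                           & finite_ring (B i)]),
            commutative_ring A
          & distributive_ring A]
    & forall (n : nat) (B : 'I_n.+1 -> nzRingType),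
        (forall i, [/\ commutative_ring (B i), uniserial_ring (B i)
                     & finite_ring (B i)]) ->
        [/\ commutative_ring (ring_prod B), distributive_ring (ring_prod B)
          & finite_ring (ring_prod B)]]
  /\
  (* (2) *)
  [/\ forall A : nzRingType,
        right_distributive_ring A ->
        right_noetherian_ring A \/ left_noetherian_ring A ->
        centrally_essential A ->
        [/\ exists (n : nat) (B : 'I_n.+1 -> nzRingType),
              ring_isomorphic A (ring_prod B) /\
              (forall i, (uniserial_ring (B i) /\ artinian_ring (B i)) \/
                         is_dedekind_domain (B i)),
            distributive_ring A
          & noetherian_ring A],
      forall (n : nat) (B : 'I_n.+1 -> nzRingType),
        (forall i, (uniserial_ring (B i) /\ artinian_ring (B i)) \/
                   is_dedekind_domain (B i)) ->
        distributive_ring (ring_prod B) /\ noetherian_ring (ring_prod B),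
      exists (n : nat) (B : 'I_n.+1 -> nzRingType),
        (forall i, (uniserial_ring (B i) /\ artinian_ring (B i)) \/
                   is_dedekind_domain (B i)) /\
        ~ commutative_ring (ring_prod B)
    & exists A : nzRingType,
        [/\ uniserial_ring A, artinian_ring A, centrally_essential A
          & ~ commutative_ring A]].
Proof.
have forward A : right_distributive_ring A ->
    right_noetherian_ring A \/ left_noetherian_ring A -> centrally_essential A ->
    exists (n : nat) (B : 'I_n.+1 -> nzRingType), ring_isomorphic A (ring_prod B) /\
      forall i, (uniserial_ring (B i) /\ artinian_ring (B i)) \/ is_dedekind_domain (B i).
  move=> /right_distributiveP arith /noetherian_acc acc ce.
  apply: (@indecomposable_factors A (fun B =>
    (uniserial_ring B /\ artinian_ring B) \/ is_dedekind_domain B)) => //.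
  move=> B _ arithB accB ceB indB.
  have [[mulC dom]|local] := indecomposable_dichotomy arithB ceB accB indB.
    by right; exact: commutative_domain_dedekind.
  by left; exact: local_uniserial_artinian.
have backward n (B : 'I_n.+1 -> nzRingType) :
    (forall i, (uniserial_ring (B i) /\ artinian_ring (B i)) \/ is_dedekind_domain (B i)) ->
    distributive_ring (ring_prod B) /\ noetherian_ring (ring_prod B).
  move=> H; have dn i : distributive_ring (B i) /\ noetherian_ring (B i).
    have [[uni art]|] := H i; last exact: dedekind_distributive_noetherian.
    by split; [exact: uniserial_distributive|exact: uniserial_artinian_noetherian].
  split; first by apply: product_distributive => i; case: (dn i).
  by apply: product_noetherian_ring => i; case: (dn i).
have [X [Xuni Xart Xce Xnc]] := noncommutative_example.
split; split.
- move=> A /right_distributiveP arith ce fin; have acc := finite_acc fin.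
  have [n [B [iso BP]]] : exists (n : nat) (B : 'I_n.+1 -> nzRingType),
      ring_isomorphic A (ring_prod B) /\
      forall i, [/\ commutative_ring (B i), uniserial_ring (B i) & finite_ring (B i)].
    apply: (@indecomposable_factors A (fun B =>
      [/\ commutative_ring B, uniserial_ring B & finite_ring B])) => //.
    move=> B sur arithB accB ceB indB.
    have finB : finite_ring B := surjects_onto_finite sur fin.
    have local : forall a : B, invertible a \/ nilpotent a.
      have [[_ dom]|//] := indecomposable_dichotomy arithB ceB accB indB.
      exact: finite_domain_local.
    have [uni _] := local_uniserial_artinian local arithB accB ceB.
    by split=> //; exact: finite_local_commutative.
  have [_ BA] := isomorphic_surjects iso.
  split; first by exists n, B.
    apply: (surjects_onto_commutative BA); apply: product_commutative => i.
    by case: (BP i).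
  apply: (surjects_onto_distributive BA); apply: product_distributive => i.
  by case: (BP i) => _ /uniserial_distributive.
- move=> n B BP; split.
  + by apply: product_commutative => i; case: (BP i).
  + by apply: product_distributive => i; case: (BP i) => _ /uniserial_distributive.
  by apply: product_finite => i; case: (BP i).
- move=> A dist noeth ce; have [n [B [iso BP]]] := forward A dist noeth ce.
  have [_ BA] := isomorphic_surjects iso; have [distB noethB] := backward n B BP.
  split; first by exists n, B.
    exact: surjects_onto_distributive distB.
  exact: surjects_onto_noetherian_ring noethB.
- exact: backward.
- exists 0%N, (fun=> X); split=> [i|mulC]; first by left.
  by apply: Xnc => x y; have := mulC (fun=> x) (fun=> y) => /(congr1 (fun z => z ord0)).
by exists X.
Qed.
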